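(* Let $D=(V,A)$ be an oriented graph with maximum degree $\Delta=\Delta(D)\ge 1$, equipped with an arc weight function $w\colon A\to\mathbb{R}_{\ge 0}$. Then there is an ordering $\sigma$ of $V$ with $$w(\mathrm{fwd}(\sigma))-w(\mathrm{back}(\sigma))\;\ge\;\frac{\sqrt2}{6}\sum_{v\in V}w_2(v)\;\ge\;\frac{\sqrt2\,w(D)}{3\sqrt{\Delta}}.$$ Consequently, $$\mathrm{fas}_w(D)\;\le\;\frac{w(D)}{2}-\frac{\sqrt2}{12}\sum_{v\in V}w_2(v)\;\le\;\Bigl(\frac12-\frac{\sqrt2}{6\sqrt{\Delta}}\Bigr)w(D).$$ All four inequalities hold with equality when $D$ is the directed triangle with all arc weights equal to $1$ (for the first inequality this means that the maximum of $w(\mathrm{fwd}(\sigma))-w(\mathrm{back}(\sigma))$ over all orderings $\sigma$ equals the right-hand side). Therefore $$c^*:=\inf_{D}\ \sqrt{\Delta(D)}\,\Bigl(\frac12-\frac{\mathrm{fas}_w(D)}{w(D)}\Bigr)=\frac{\sqrt2}{6},$$ where the infimum ranges over all weighted oriented graphs $D$ with $\Delta(D)\ge 1$ and $w(D)>0$.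
   Context: All digraphs are finite. An oriented graph is a digraph $D=(V,A)$ with no loops and no directed $2$-cycles (so between any two distinct vertices there is at most one arc). A weighted oriented graph is an oriented graph with a function $w\colon A\to\mathbb{R}_{\ge0}$; for $S\subseteq A$, $w(S)=\sum_{e\in S}w(e)$, and $w(D)=w(A)$. The degree of $v$ is $d(v)=d^+(v)+d^-(v)$ (out-degree plus in-degree) and $\Delta(D)=\max_{v\in V}d(v)$ (independent of the weights). For $v\in V$, $w_2(v)=\bigl(\sum_{e\ni v}w(e)^2\bigr)^{1/2}$, the sum being over all arcs $e$ incident with $v$. A feedback arc set is a set $F\subseteq A$ such that $D-F$ is acyclic; $\mathrm{fas}_w(D)$ is the minimum of $w(F)$ over feedback arc sets $F$. For an ordering $\sigma=v_1v_2\cdots v_n$ of $V$, an arc $v_iv_j$ (from $v_i$ to $v_j$) is forward if $i<j$ and backward if $i>j$; $\mathrm{fwd}(\sigma)$ and $\mathrm{back}(\sigma)$ are the sets of forward and backward arcs. *)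

(* Defs.v *)
From HB Require Import structures.
From mathcomp Require Import all_boot all_order all_algebra.
From mathcomp Require Import all_classical all_reals.

Set Implicit Arguments.
Unset Strict Implicit.
Unset Printing Implicit Defensive.

Import Order.TTheory GRing.Theory Num.Theory.

Local Open Scope ring_scope.

(* A digraph on V is given by its set A of arcs; (x, y) is the arc from x
   to y. *)
Section Digraph.
Variable V : finType.
Implicit Types (A B F : {set V * V}) (v : V) (s : seq V).

Definition oriented A : Prop :=
  (forall x, (x, x) \notin A)
  /\ (forall x y, (x, y) \in A -> (y, x) \notin A).

Definition outdeg A v : nat := #|[set e in A | e.1 == v]|.
Definition indeg A v : nat := #|[set e in A | e.2 == v]|.
Definition deg A v : nat := (outdeg A v + indeg A v)%N.
Definition maxdeg A : nat := \max_(v : V) deg A v.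

Definition incident v (e : V * V) : bool := (e.1 == v) || (e.2 == v).

(* ucycle ranges over directed cycles with pairwise distinct vertices;
   the empty sequence counts as a ucycle and is not a cycle of the digraph. *)
Definition acyclic B : Prop :=
  forall c : seq V, ucycle [rel x y | (x, y) \in B] c -> c = [::].

Definition feedback_arc_set A F : Prop := F \subset A /\ acyclic (A :\: F).

Definition is_ordering s : Prop := perm_eq s (enum V).

Definition fwd A s : {set V * V} :=
  [set e in A | (index e.1 s < index e.2 s)%N].
Definition back A s : {set V * V} :=
  [set e in A | (index e.2 s < index e.1 s)%N].

End Digraph.

(* Weight functions are defined on all pairs, but only their values on arcs
   are constrained or used. *)
Section Weighted.
Variables (R : realType) (V : finType).
Implicit Types (A S : {set V * V}) (w : V * V -> R) (v : V).

Definition weighting A w : Prop := forall e, e \in A -> 0 <= w e.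

Definition weight w S : R := \sum_(e in S) w e.

Definition w2 A w v : R := Num.sqrt (\sum_(e in A | incident v e) w e ^+ 2).

(* The default value weight w A does not affect the minimum: A is itself a
   feedback arc set. *)
Definition fas A w : R :=
  \big[Num.min/weight w A]_(F : {set V * V} | `[< feedback_arc_set A F >])
     weight w F.

End Weighted.

Definition triangle : {set 'I_3 * 'I_3} := [set e | e.2 == ordS e.1].

Definition unit_weight (R : realType) (V : finType) : V * V -> R := fun=> 1.
Arguments unit_weight {R V} _.

Definition fas_ratios (R : realType) : set R :=
  [set x : R | exists (V : finType) (A : {set V * V}) (w : V * V -> R),
     [/\ oriented A, weighting A w, (1 <= maxdeg A)%N, 0 < weight w A
       & x = Num.sqrt (maxdeg A)%:R * (1 / 2 - fas A w / weight w A)]]%classic.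
Arguments fas_ratios : clear implicits.

(* Main.v *)
Require Import Defs.
From HB Require Import structures.
From mathcomp Require Import all_boot all_order all_algebra.
From mathcomp Require Import all_classical all_reals.
From mathcomp Require Import polyrcf.
From mathcomp Require Import ring lra.

Set Implicit Arguments.
Unset Strict Implicit.
Unset Printing Implicit Defensive.

Import Order.TTheory GRing.Theory Num.Theory.

Local Open Scope ring_scope.

(** Write net(v, u) = w(vu) - w(uv), where arcs that are absent weigh 0.  Build
    an ordering by taking the vertices one at a time and placing each in front
    of, or behind, all the vertices that remain, whichever is better: a vertex v
    then gains |sum of net(v, u) over the remaining u|, and the gains add up to
    w(fwd) - w(back).  If the vertices are taken in a uniformly random order,
    the vertices that remain when v is taken form a random set X, obtained by
    drawing a time t uniformly in [0, 1] and keeping each vertex other than v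
    independently with probability t.  Some choice does at least as well as the
    mean ([greedy_order]), so everything reduces to one inequality for real
    vectors a, applied at each vertex to a = net(v, _), whose Euclidean norm is
    w_2(v):

      the mean of |sum of a_i over i in X| is at least sqrt 2 / 6 * ||a||

    ([mean_imbalance_ge]).  The vector (1, -1), which is what each vertex of the
    triangle sees, gives equality.

    Averaging X with its complement, it is enough to show that
    int_0^1 E_t |S| dt >= sqrt 2 / 3 * ||a|| for S = sum of a_i eps_i, where
    the signs eps_i are independent and equal to +1 with probability t.  Split S
    into two independent parts P + Q.  The energy inequality compares the law
    of P with that of - Q and yields

      E|P + Q| >= (E|P - P'| + E|Q - Q'|) / 2

    with P', Q' independent copies ([energy_split]).  The variable P - P' is a
    sum of independent steps; each of them is 0, except with probability
    4 t (1 - t), when it is a coefficient times a sum of two fair signs.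
    Khintchine's inequality with Szarek's constant 1 / sqrt 2 then gives
    E|P - P'| >= 4 t (1 - t) ||P|| ([self_distance_ge]), with ||P|| the norm of
    the coefficients of P.  If the two parts have equal norms, the identity
    ||P|| + ||Q|| = sqrt 2 ||a|| and the mean 2 / 3 of 4 t (1 - t) finish the
    proof.

    In general take a split that is as balanced as possible.  If it is not
    balanced, and the heavier part has at least two nonzero coefficients, then
    each of them is at least of the order of the imbalance, and the concavity of
    the square root improves the bound on E|P - P'| by enough to compensate
    ([certified_balanced]).  If the heavier part has only one, say 1, then this one
    dominates all the others together, and S = eps_1 + Q.  When Q is not small,
    conditioning on eps_1 and the energy inequality leave only a quadratic in the
    mean of the truncation of Q to [-1, 1]; when Q is small, Jensen's inequality
    suffices ([certified_dominant]).

    The remaining inequalities follow by Cauchy-Schwarz at each vertex and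
    because the backward arcs of an ordering form a feedback arc set.  In the
    triangle every feedback arc set is nonempty, hence weighs at least 1, so that
    all the bounds and the infimum are attained there. *)

(** * Khintchine's inequality with the constant of Szarek *)

Section Cube.
Variable R : rcfType.
Implicit Types (f g h : seq bool -> R) (cs : seq R).

(** Functions on the n-cube are encoded as functions on bit lists, of which only
    the values on lists of length n matter; removing the head bit is then the
    induction on the dimension. *)
Fixpoint cube_mean n f : R :=
  if n is k.+1 then
    (cube_mean k (fun x => f (true :: x)) + cube_mean k (fun x => f (false :: x))) / 2
  else f [::].

Definition halfsum f x : R := (f (true :: x) + f (false :: x)) / 2.
Definition halfdiff f x : R := (f (true :: x) - f (false :: x)) / 2.

(** The Dirichlet form of the cube: the mean of the sum over the coordinates i
    of ((f x - f (x with bit i flipped)) / 2) ^ 2. *)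
Fixpoint dirichlet n f : R :=
  if n is k.+1 then
    (dirichlet k (fun x => f (true :: x)) + dirichlet k (fun x => f (false :: x))) / 2
    + cube_mean k (fun x => halfdiff f x ^+ 2)
  else 0.

(** The sum of the squares of the Fourier-Walsh coefficients of degree 1. *)
Fixpoint level1 n f : R :=
  if n is k.+1 then level1 k (halfsum f) + cube_mean k (halfdiff f) ^+ 2 else 0.

Lemma cube_mean_lin n a b f g :
  cube_mean n (fun x => a * f x + b * g x) = a * cube_mean n f + b * cube_mean n g.
Proof. by elim: n f g => [|n IH] f g //=; rewrite !IH; field. Qed.

Lemma cube_mean_ge0 n f : (forall x, 0 <= f x) -> 0 <= cube_mean n f.
Proof.
elim: n f => [|n IH] f f_ge0 //=.
by have := IH (fun x => f (true :: x)) (fun x => f_ge0 _);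
   have := IH (fun x => f (false :: x)) (fun x => f_ge0 _); lra.
Qed.

Lemma cube_mean_const n c : cube_mean n (fun=> c) = c.
Proof. by elim: n => //= n ->; field. Qed.

Lemma cube_mean_parallelogram n f g :
  cube_mean n (fun x => (f x + g x) ^+ 2) + cube_mean n (fun x => (f x - g x) ^+ 2)
  = 2 * (cube_mean n (fun x => f x ^+ 2) + cube_mean n (fun x => g x ^+ 2)).
Proof.
elim: n f g => [|n IH] f g /=; first by ring.
have := IH (fun x => f (true :: x)) (fun x => g (true :: x)).
have := IH (fun x => f (false :: x)) (fun x => g (false :: x)).
by move=> /= h1 h2; lra.
Qed.

Lemma dirichlet_parallelogram n f g :
  dirichlet n (fun x => f x + g x) + dirichlet n (fun x => f x - g x)
  = 2 * (dirichlet n f + dirichlet n g).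
Proof.
elim: n f g => [|n IH] f g /=; first by ring.
have h1 := IH (fun x => f (true :: x)) (fun x => g (true :: x)).
have h2 := IH (fun x => f (false :: x)) (fun x => g (false :: x)).
have h3 := cube_mean_parallelogram n (halfdiff f) (halfdiff g).
have eD : (fun x => halfdiff (fun y => f y + g y) x ^+ 2)
          = (fun x => (halfdiff f x + halfdiff g x) ^+ 2).
  by apply/funext => x; rewrite /halfdiff; field.
have eB : (fun x => halfdiff (fun y => f y - g y) x ^+ 2)
          = (fun x => (halfdiff f x - halfdiff g x) ^+ 2).
  by apply/funext => x; rewrite /halfdiff; field.
by rewrite eD eB; lra.
Qed.

Lemma fun_true f : (fun x => f (true :: x)) = (fun x => halfsum f x + halfdiff f x).
Proof. by apply/funext => x; rewrite /halfsum /halfdiff; field. Qed.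

Lemma fun_false f : (fun x => f (false :: x)) = (fun x => halfsum f x - halfdiff f x).
Proof. by apply/funext => x; rewrite /halfsum /halfdiff; field. Qed.

Lemma cube_mean_halfsum n f : cube_mean n.+1 f = cube_mean n (halfsum f).
Proof.
rewrite /= mulrDl -![_ / 2]mulrC -cube_mean_lin; congr cube_mean.
by apply/funext => x; rewrite /halfsum; field.
Qed.

Lemma cube_mean_sqr n f :
  cube_mean n.+1 (fun x => f x ^+ 2)
  = cube_mean n (fun x => halfsum f x ^+ 2) + cube_mean n (fun x => halfdiff f x ^+ 2).
Proof.
have := cube_mean_parallelogram n (halfsum f) (halfdiff f) => /=.
have -> : (fun x => f (true :: x) ^+ 2) = (fun x => (halfsum f x + halfdiff f x) ^+ 2).
  by apply/funext => x; rewrite /halfsum /halfdiff; field.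
have -> : (fun x => f (false :: x) ^+ 2) = (fun x => (halfsum f x - halfdiff f x) ^+ 2).
  by apply/funext => x; rewrite /halfsum /halfdiff; field.
by move=> ?; lra.
Qed.

Lemma dirichlet_split n f :
  dirichlet n.+1 f
  = dirichlet n (halfsum f) + dirichlet n (halfdiff f)
    + cube_mean n (fun x => halfdiff f x ^+ 2).
Proof.
rewrite /= fun_true fun_false.
by have := dirichlet_parallelogram n (halfsum f) (halfdiff f); lra.
Qed.

Definition variance n f : R := cube_mean n (fun x => f x ^+ 2) - cube_mean n f ^+ 2.

Lemma poincare n f : variance n f <= dirichlet n f.
Proof.
elim: n f => [|n IH] f; first by rewrite /variance /= subrr.
rewrite dirichlet_split /variance cube_mean_sqr cube_mean_halfsum.
have := IH (halfsum f); have := IH (halfdiff f); rewrite /variance.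
have : 0 <= dirichlet n (halfdiff f).
  elim: n (halfdiff f) {IH} => [|n IH] g //=.
  have := IH (fun x => g (true :: x)); have := IH (fun x => g (false :: x)).
  have := @cube_mean_ge0 n (fun x => halfdiff g x ^+ 2) (fun x => sqr_ge0 _).
  by lra.
by lra.
Qed.

(** Once the first Fourier level is removed the spectral gap of the cube is 2
    instead of 1.  In the induction, [halfdiff f] contributes the square of its
    mean to the first level, and its variance is controlled by the ordinary
    Poincare inequality one dimension lower. *)
Lemma poincare_level1 n f : 2 * variance n f <= dirichlet n f + level1 n f.
Proof.
elim: n f => [|n IH] f; first by rewrite /variance /= subrr; lra.
rewrite dirichlet_split /variance cube_mean_sqr cube_mean_halfsum /=.
by have := IH (halfsum f); have := poincare n (halfdiff f); rewrite /variance; lra.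
Qed.

Lemma cube_mean_negb n f : cube_mean n (fun x => f (map negb x)) = cube_mean n f.
Proof.
elim: n f => [|n IH] f //=.
by rewrite (IH (fun x => f (false :: x))) (IH (fun x => f (true :: x))) addrC.
Qed.

Lemma cube_mean_odd n f : (forall x, f (map negb x) = - f x) -> cube_mean n f = 0.
Proof.
move=> f_odd; have := cube_mean_negb n f.
under eq_fun => x do rewrite f_odd -[- f x]add0r -[f x]mul1r -mulNr -[0](mul0r 0).
by rewrite (cube_mean_lin n 0 (-1) (fun=> 0)); lra.
Qed.

Lemma level1_even n f : (forall x, f (map negb x) = f x) -> level1 n f = 0.
Proof.
elim: n f => [|n IH] f f_even //=.
have fE b x : f (b :: map negb x) = f (~~ b :: x).
  by rewrite -[RHS]f_even /= negbK.
rewrite IH => [|x]; last by rewrite /halfsum !fE /= addrC.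
rewrite cube_mean_odd ?expr0n ?addr0 //= => x.
by rewrite /halfdiff !fE /=; lra.
Qed.

Fixpoint signed_sum cs (x : seq bool) : R :=
  match cs, x with
  | a :: as', b :: x' => (if b then a else - a) + signed_sum as' x'
  | _, _ => 0
  end.

Definition sumsq cs : R := \sum_(a <- cs) a ^+ 2.

Lemma sumsq_nil : sumsq [::] = 0. Proof. exact: big_nil. Qed.
Lemma sumsq_cons a cs : sumsq (a :: cs) = a ^+ 2 + sumsq cs.
Proof. exact: big_cons. Qed.
Lemma sumsq_ge0 cs : 0 <= sumsq cs.
Proof. by apply: sumr_ge0 => a _; apply: sqr_ge0. Qed.

Fixpoint rademacher cs (phi : R -> R) (z : R) : R :=
  if cs is a :: as' then
    (rademacher as' phi (z + a) + rademacher as' phi (z - a)) / 2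
  else phi z.

Lemma rademacherE cs phi z :
  rademacher cs phi z = cube_mean (size cs) (fun x => phi (z + signed_sum cs x)).
Proof.
elim: cs z => [|a cs IH] z /=; first by rewrite addr0.
by rewrite !IH; congr ((cube_mean _ _ + cube_mean _ _) / 2);
   apply/funext => x; rewrite addrA.
Qed.

Lemma rademacher_sqr cs z :
  rademacher cs (fun u => u ^+ 2) z = z ^+ 2 + sumsq cs.
Proof.
elim: cs z => [|a cs IH] z /=; rewrite ?sumsq_nil ?sumsq_cons ?addr0 //.
by rewrite !IH; field.
Qed.

(** Flipping the sign of a coefficient c changes the norm by at most 2 |c|. *)
Lemma dirichlet_norm cs z :
  dirichlet (size cs) (fun x => `|z + signed_sum cs x|) <= sumsq cs.
Proof.
elim: cs z => [|a cs IH] z; first by rewrite sumsq_nil.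
have IHs c : dirichlet (size cs) (fun x => `|z + (c + signed_sum cs x)|)
             <= sumsq cs.
  by under eq_fun => x do rewrite addrA; exact: IH.
rewrite sumsq_cons /=.
have := IHs a; have := IHs (- a).
set d := cube_mean _ _; suff : d <= a ^+ 2 by lra.
rewrite -[leRHS](cube_mean_const (size cs)) -subr_ge0.
have -> : forall n f, cube_mean n (fun=> a ^+ 2) - cube_mean n f
    = cube_mean n (fun x => 1 * a ^+ 2 + -1 * f x).
  by move=> n f; rewrite (cube_mean_lin n 1 (-1) (fun=> a ^+ 2)); lra.
apply: cube_mean_ge0 => x; rewrite /halfdiff /=.
rewrite mul1r mulN1r subr_ge0 -[leLHS]real_normK ?num_real //.
rewrite -[leRHS]real_normK ?num_real // lerXn2r ?nnegrE //.
set u := signed_sum _ _.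
have := ler_dist_dist (z + (a + u)) (z + (- a + u)).
have -> : z + (a + u) - (z + (- a + u)) = a *+ 2 by ring.
by rewrite normrM [`|2^-1|]ger0_norm ?invr_ge0 // normrMn; lra.
Qed.

(** The proof of Latala and Oleszkiewicz.  The function f = |signed sum| is even,
    so twice its variance is at most its Dirichlet form, hence at most
    sumsq cs = E f ^ 2; this says that (E f) ^ 2 >= sumsq cs / 2.  Two equal
    coefficients give equality. *)
Lemma khintchine cs :
  Num.sqrt (sumsq cs) / Num.sqrt 2 <= rademacher cs Num.norm 0.
Proof.
rewrite rademacherE; set f := (fun x => `|0 + signed_sum cs x|).
set n := size cs.
have f_even x : f (map negb x) = f x.
  rewrite /f !add0r; suff -> : signed_sum cs (map negb x) = - signed_sum cs x.
    by rewrite normrN.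
  elim: cs x {f n} => [|a cs IH] [|b x] /=; rewrite ?oppr0 //.
  by rewrite IH; case: b => /=; ring.
have Ef0 : 0 <= cube_mean n f by apply: cube_mean_ge0 => x; apply: normr_ge0.
have f2 : cube_mean n (fun x => f x ^+ 2) = sumsq cs.
  have := rademacher_sqr cs 0; rewrite rademacherE expr0n add0r => <-.
  by congr cube_mean; apply/funext => x; rewrite /f real_normK ?num_real.
have := poincare_level1 n f; rewrite level1_even // /variance f2 addr0.
have := dirichlet_norm cs 0; rewrite -/n -/f => hD hP.
have s2 : 0 < Num.sqrt 2 :> R by rewrite sqrtr_gt0.
rewrite ler_pdivrMr //.
have rhs_ge0 : 0 <= cube_mean n f * Num.sqrt 2 by rewrite mulr_ge0 // ltW.
rewrite -(ler_pXn2r (n := 2)) ?nnegrE ?sqrtr_ge0 //.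
rewrite exprMn !sqr_sqrtr ?sumsq_ge0 //.
by lra.
Qed.

End Cube.

(** * The energy inequality for signed measures on the line *)

Section Energy.
Variable R : rcfType.
Implicit Types (m : seq (R * R)) (phi psi : R -> R).

(** A finitely supported signed measure is a list of atoms (weight, position). *)
Definition integ m phi : R := \sum_(d <- m) d.1 * phi d.2.

Lemma integ_lin m a b phi psi :
  integ m (fun u => a * phi u + b * psi u) = a * integ m phi + b * integ m psi.
Proof.
rewrite /integ !mulr_sumr -big_split /=; apply: eq_bigr => d _; ring.
Qed.

Lemma integZ m a phi : integ m (fun u => a * phi u) = a * integ m phi.
Proof. by rewrite /integ mulr_sumr; apply: eq_bigr => d _; ring. Qed.

Lemma integD m phi psi :
  integ m (fun u => phi u + psi u) = integ m phi + integ m psi.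
Proof. by rewrite /integ -big_split; apply: eq_bigr => d _; rewrite mulrDr. Qed.

Lemma integ_cat m1 m2 phi : integ (m1 ++ m2) phi = integ m1 phi + integ m2 phi.
Proof. exact: big_cat. Qed.

Lemma integ_cons d m phi : integ (d :: m) phi = d.1 * phi d.2 + integ m phi.
Proof. exact: big_cons. Qed.

Lemma integ_map m c (k : R -> R) phi :
  integ [seq (c * d.1, k d.2) | d <- m] phi = c * integ m (phi \o k).
Proof. by rewrite /integ big_map mulr_sumr; apply: eq_bigr => d _ /=; ring. Qed.

Lemma perm_integ m1 m2 phi : perm_eq m1 m2 -> integ m1 phi = integ m2 phi.
Proof. exact: perm_big. Qed.

Lemma eq_integ_in m phi psi :
  (forall d, d \in m -> phi d.2 = psi d.2) -> integ m phi = integ m psi.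
Proof. by move=> e; apply: eq_big_seq => d /e ->. Qed.

Lemma le_integ m phi psi :
  (forall d, d \in m -> 0 <= d.1) -> (forall u, phi u <= psi u) ->
  integ m phi <= integ m psi.
Proof.
move=> m_ge0 le_phi; rewrite /integ big_seq [leRHS]big_seq.
by apply: ler_sum => d /m_ge0 d_ge0; rewrite ler_wpM2l.
Qed.

Definition mass m : R := integ m (fun=> 1).

Lemma integ_const m c : integ m (fun=> c) = c * mass m.
Proof. by rewrite -integZ; congr integ; apply/funext => u; rewrite mulr1. Qed.

Lemma integ_exchange m1 m2 (k : R -> R -> R) :
  integ m1 (fun u => integ m2 (k u)) = integ m2 (fun v => integ m1 (k^~ v)).
Proof.
rewrite /integ; under eq_bigr do rewrite mulr_sumr.
rewrite exchange_big; apply: eq_bigr => d _; rewrite mulr_sumr.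
by apply: eq_bigr => e _ /=; rewrite mulrCA.
Qed.

(** Moving the origin to the leftmost atom subtracts from the form a nonnegative
    multiple of the square of the mass, and that atom then drops out of the
    form; induct on the number of atoms. *)
Lemma min_psd m :
  (forall d, d \in m -> 0 <= d.2) ->
  0 <= integ m (fun u => integ m (fun v => Num.min u v)).
Proof.
have [n] := ubnP (size m); elim: n m => // n IH m lt_m m_ge0.
case: m => [|d0 m0] in lt_m m_ge0 *; first by rewrite /integ big_nil.
have [d d_m d_min] : exists2 d, d \in d0 :: m0
    & forall e, e \in d0 :: m0 -> d.2 <= e.2.
  elim: m0 d0 {lt_m m_ge0 IH} => [|d1 m IH] d0.
    by exists d0; rewrite ?mem_head // => e; rewrite inE => /eqP ->.
  have [d d_m d_min] := IH d1.
  have [le_d|/ltW le_d] := lerP d.2 d0.2.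
    exists d; first by rewrite inE d_m orbT.
    by move=> e; rewrite inE => /predU1P[->|/d_min].
  exists d0; first exact: mem_head.
  by move=> e; rewrite inE => /predU1P[->|/d_min/(le_trans le_d)].
have perm_m := perm_to_rem d_m; set m := rem d _ in perm_m.
have size_m : (size m < n)%N by rewrite size_rem.
have -> : integ (d0 :: m0) (fun u => integ (d0 :: m0) (fun v => Num.min u v))
    = integ (d :: m) (fun u => integ (d :: m) (fun v => Num.min u v)).
  rewrite (perm_integ _ perm_m); congr integ; apply/funext => u.
  exact: perm_integ.
have {}d_min e : e \in d :: m -> d.2 <= e.2.
  by rewrite -(perm_mem perm_m); apply: d_min.
have d_ge0 := m_ge0 d d_m.
pose m' := [seq (1 * e.1, e.2 - d.2) | e <- m].
have m'_ge0 : 0 <= integ m' (fun u => integ m' (fun v => Num.min u v)).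
  apply: IH => [|e /mapP[e' e'_m ->] /=]; first by rewrite size_map.
  by rewrite subr_ge0 d_min // inE e'_m orbT.
suff -> : integ (d :: m) (fun u => integ (d :: m) (fun v => Num.min u v))
    = integ m' (fun u => integ m' (fun v => Num.min u v))
      + d.2 * mass (d :: m) ^+ 2.
  by rewrite addr_ge0 // mulr_ge0 ?sqr_ge0.
have m'E phi : integ m' phi = integ m (fun u => phi (u - d.2)).
  by rewrite /m' (integ_map _ _ (fun u => u - d.2)) mul1r.
pose k u := integ m (fun v => Num.min (u - d.2) (v - d.2)).
rewrite [X in _ = X + _]m'E [X in _ = integ m X + _](_ : _ = k); last first.
  by apply/funext => u; rewrite m'E.
have kE u : u \in [seq e.2 | e <- d :: m] ->
    integ (d :: m) (fun v => Num.min u v) = d.2 * mass (d :: m) + k u.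
  move=> /mapP[e e_m ->] {u}.
  rewrite /mass /k !integ_cons mulr1 min_r ?d_min //.
  have -> : integ m [eta Num.min e.2]
      = integ m (fun v => d.2 * 1 + 1 * Num.min (e.2 - d.2) (v - d.2)).
    congr integ; apply/funext => v; rewrite mulr1 mul1r addr_minr.
    by rewrite !(addrC d.2) !subrK.
  by rewrite (integ_lin m d.2 1 (fun=> 1)); ring.
have -> : integ (d :: m) (fun u => integ (d :: m) (fun v => Num.min u v))
    = integ (d :: m) (fun u => d.2 * mass (d :: m) + 1 * k u).
  by apply: eq_integ_in => e e_m; rewrite kE ?mul1r // map_f.
rewrite (integ_lin _ _ _ (fun=> _)) integ_const /=.
have -> : integ (d :: m) k = integ m k.
  rewrite integ_cons /k subrr.
  have -> : integ m (fun v => Num.min 0 (v - d.2)) = integ m (fun=> 0).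
    apply: eq_integ_in => e e_m.
    by rewrite min_l // subr_ge0 d_min // inE e_m orbT.
  by rewrite integ_const mul0r mulr0 add0r.
ring.
Qed.

(** Since |u - v| = u + v - 2 min(u, v) and a measure of mass 0 kills the terms
    that depend on one variable only, this is the positivity of the kernel
    min. *)
Lemma energy m : mass m = 0 ->
  integ m (fun u => integ m (fun v => `|u - v|)) <= 0.
Proof.
move=> m0.
have [b b_le] : exists b, forall d, d \in m -> b <= d.2.
  exists (- \sum_(d <- m) `|d.2|) => d d_m.
  rewrite lerNl (le_trans (ler_norm _)) // normrN (big_rem d d_m) /=.
  by rewrite lerDl sumr_ge0.
pose m' := [seq (1 * e.1, e.2 - b) | e <- m].
have m'E phi : integ m' phi = integ m (fun u => phi (u - b)).
  by rewrite /m' (integ_map _ _ (fun u => u - b)) mul1r.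
have := @min_psd m'; rewrite m'E; under eq_fun do rewrite m'E; move=> psd.
have {psd} : 0 <= integ m (fun u => integ m (fun v => Num.min (u - b) (v - b))).
  by apply: psd => d /mapP[e e_m ->] /=; rewrite subr_ge0 b_le.
have -> : (fun u => integ m (fun v => `|u - v|))
    = (fun u => integ m (fun v => v - b)
                + -2 * integ m (fun v => Num.min (u - b) (v - b))).
  apply/funext => u; rewrite -integZ -integD.
  have -> : integ m (fun v => `|u - v|)
      = integ m (fun v => (u - b) * 1 + 1 * (v - b + -2 * Num.min (u - b) (v - b))).
    congr integ; apply/funext => v.
    have [le_uv|lt_vu] := leP (u - b) (v - b).
      by rewrite ler0_norm; [ring|lra].
    by rewrite gtr0_norm; [ring|lra].
  by rewrite (integ_lin _ _ _ (fun=> 1)) -/(mass m) m0 mulr0 add0r mul1r.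
set c := integ m (+%R^~ (- b)).
by rewrite integD integ_const m0 mulr0 add0r integZ; lra.
Qed.

End Energy.

(** * Sums of independent biased signs *)

Section Law.
Variable R : rcfType.
Implicit Types (t x z s : R) (cs ds : seq R) (phi psi : R -> R).

(** The law of the sum of the c eps_c over the entries c of the list, for
    independent signs eps_c that are +1 with probability t. *)
Fixpoint law t cs : seq (R * R) :=
  if cs is a :: cs' then
    [seq (t * d.1, a + d.2) | d <- law t cs']
    ++ [seq ((1 - t) * d.1, - a + d.2) | d <- law t cs']
  else [:: (1, 0)].

Definition expect t cs phi : R := integ (law t cs) phi.

Lemma expect_nil t phi : expect t [::] phi = phi 0.
Proof. by rewrite /expect /integ /= big_seq1 mul1r. Qed.

Lemma expect_cons t a cs phi :
  expect t (a :: cs) phi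
  = t * expect t cs (fun u => phi (a + u))
    + (1 - t) * expect t cs (fun u => phi (- a + u)).
Proof. by rewrite /expect integ_cat !integ_map. Qed.

Lemma law_ge0 t cs d : 0 <= t <= 1 -> d \in law t cs -> 0 <= d.1.
Proof.
move=> /andP[t_ge0 t_le1]; elim: cs d => [|a cs IH] d /=.
  by rewrite inE => /eqP -> /=.
by rewrite mem_cat => /orP[] /mapP[e /IH e_ge0 ->] /=;
   rewrite mulr_ge0 // subr_ge0.
Qed.

Lemma mass_law t cs : mass (law t cs) = 1.
Proof.
rewrite /mass -/(expect t cs _); elim: cs => [|a cs IH].
  by rewrite expect_nil.
by rewrite expect_cons IH; ring.
Qed.

Lemma expect_const t cs c : expect t cs (fun=> c) = c.
Proof. by rewrite /expect integ_const mass_law mulr1. Qed.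

Lemma le_expect t cs phi psi : 0 <= t <= 1 ->
  (forall u, phi u <= psi u) -> expect t cs phi <= expect t cs psi.
Proof. by move=> t01; apply: le_integ => d; apply: law_ge0. Qed.

Lemma expect_id t cs : expect t cs id = (2 * t - 1) * \sum_(a <- cs) a.
Proof.
elim: cs => [|a cs IH]; first by rewrite expect_nil big_nil mulr0.
rewrite expect_cons big_cons.
by rewrite /expect !integD !integ_const mass_law -/(expect t cs id) IH; ring.
Qed.

Lemma jensen_norm t cs c : 0 <= t <= 1 ->
  `|c + (2 * t - 1) * \sum_(a <- cs) a| <= expect t cs (fun u => `|c + u|).
Proof.
move=> t01; rewrite -expect_id; set e := expect t cs id.
have eE : expect t cs (fun u => c + u) = c + e.
  by rewrite /expect integD integ_const mass_law mulr1.
have eN : expect t cs (fun u => -1 * (c + u)) = - (c + e).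
  by rewrite /expect integZ -/(expect _ _ _) eE mulN1r.
rewrite ler_norml lerNl -eN -eE.
by rewrite !le_expect // => u; rewrite ?mulN1r ?ler_norm // -normrN ler_norm.
Qed.

Lemma expect_cat t cs ds phi :
  expect t (cs ++ ds) phi
  = expect t cs (fun u => expect t ds (fun v => phi (u + v))).
Proof.
elim: cs phi => [|a cs IH] phi.
  by rewrite expect_nil; congr expect; apply/funext => v; rewrite add0r.
rewrite cat_cons !expect_cons !IH.
by congr (_ * _ + _ * _); congr expect; apply/funext => u; congr expect;
   apply/funext => v; rewrite addrA.
Qed.

Lemma expectZ t c cs phi :
  expect t [seq c * a | a <- cs] phi = expect t cs (fun u => phi (c * u)).
Proof.
elim: cs phi => [|a cs IH] phi /=; first by rewrite !expect_nil mulr0.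
rewrite !expect_cons !IH.
by congr (_ * _ + _ * _); congr expect; apply/funext => u;
   rewrite mulrDr ?mulrN.
Qed.

(** E|P - P'|, for two independent copies P and P' of the sum. *)
Definition self_distance t cs : R :=
  expect t cs (fun u => expect t cs (fun v => `|u - v|)).

(** The energy inequality for the law of the sum over cs minus the law of the
    opposite of the sum over ds.  It replaces biased signs by the symmetric
    variables of [self_distance], and it is an equality when the two laws
    coincide. *)
Lemma energy_split t cs ds :
  (self_distance t cs + self_distance t ds) / 2
  <= expect t (cs ++ ds) Num.norm.
Proof.
pose m := law t cs ++ [seq (-1 * d.1, - d.2) | d <- law t ds].
have m0 : mass m = 0.
  by rewrite /mass integ_cat integ_map -!/(mass _) !mass_law; ring.
have := energy m0.
pose cross := expect t cs (fun u => expect t ds (fun v => `|u + v|)).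
suff -> : integ m (fun u => integ m (fun v => `|u - v|))
    = self_distance t cs + self_distance t ds - 2 * cross.
  by rewrite expect_cat -/cross; lra.
rewrite /m integ_cat integ_map.
under eq_fun do rewrite integ_cat integ_map.
rewrite integD integZ -/(self_distance t cs).
have -> : integ (law t cs)
    (fun u => integ (law t ds) (Num.norm \o +%R u \o -%R \o -%R)) = cross.
  by congr integ; apply/funext => u; congr integ; apply/funext => v /=; rewrite opprK.
rewrite [X in _ + _ + -1 * X](_ : _ = cross - self_distance t ds).
  by rewrite /self_distance /expect; ring.
have -> : cross = integ (law t ds) (fun v => integ (law t cs) (fun u => `|u + v|)).
  exact: integ_exchange.
rewrite /self_distance /expect -[- integ _ _]mulN1r -integZ -integD.
congr integ; apply/funext => u /=; congr (_ + -1 * _).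
  by congr integ; apply/funext => v; rewrite -normrN opprD !opprK addrC.
by congr integ; apply/funext => v /=; rewrite opprK distrC addrC.
Qed.

(** The mean of phi at the end of a walk from z whose step for the entry a is
    0 with probability 1 - b and 2 a or - 2 a with probability b / 2 each. *)
Fixpoint lazy_walk b cs phi z : R :=
  if cs is a :: cs' then
    (1 - b) * lazy_walk b cs' phi z
    + b / 2 * (lazy_walk b cs' phi (z + 2 * a) + lazy_walk b cs' phi (z - 2 * a))
  else phi z.

Lemma lazy_walkE t cs phi z :
  expect t cs (fun u => expect t cs (fun v => phi (z + (u - v))))
  = lazy_walk (2 * t * (1 - t)) cs phi z.
Proof.
elim: cs z => [|a cs IH] z; first by rewrite !expect_nil subrr addr0.
rewrite [LHS]expect_cons /= -!IH.
under eq_fun do rewrite expect_cons.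
under [X in _ + _ * expect _ _ X]eq_fun do rewrite expect_cons.
rewrite /expect !integD !integZ.
have e (c c' : R) : integ (law t cs) (fun u => integ (law t cs)
    (fun v => phi (z + (c + u - (c' + v)))))
  = integ (law t cs) (fun u => integ (law t cs)
      (fun v => phi (z + (c - c') + (u - v)))).
  by congr integ; apply/funext => u; congr integ; apply/funext => v;
     congr phi; ring.
rewrite !e !opprK subrr addNr addr0.
rewrite (_ : a + a = 2 * a); last by ring.
rewrite (_ : - a - a = - (2 * a)); last by ring.
by field.
Qed.

Lemma lazy_walk_lin b cs x y phi psi z :
  lazy_walk b cs (fun u => x * phi u + y * psi u) z
  = x * lazy_walk b cs phi z + y * lazy_walk b cs psi z.
Proof. by elim: cs z => [|a cs IH] z //=; rewrite !IH; ring. Qed.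

Lemma lazy_walk_shift b cs phi z c :
  lazy_walk b cs (fun u => phi (u + c)) z = lazy_walk b cs phi (z + c).
Proof.
by elim: cs z => [|a cs IH] z //=; rewrite !IH !(addrAC _ c).
Qed.

(** Keep each entry a of cs independently with probability x: this is the mean
    of sqrt (s + sum of the 2 a ^ 2 that are kept) / sqrt 2. *)
Fixpoint thinned_norm x cs s : R :=
  if cs is a :: cs' then
    (1 - x) * thinned_norm x cs' s + x * thinned_norm x cs' (s + 2 * a ^+ 2)
  else Num.sqrt s / Num.sqrt 2.

(** A step of the walk with b = x / 2 is, with probability x, the sum of two fair
    signs times a, and 0 otherwise.  Given which entries move, Khintchine's
    inequality applies to a list in which each of these entries occurs twice,
    whence the 2 a ^ 2 in [thinned_norm]. *)
Lemma lazy_walk_ge x cs ds : 0 <= x <= 1 ->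
  thinned_norm x cs (sumsq ds) <= lazy_walk (x / 2) cs (rademacher ds Num.norm) 0.
Proof.
move=> /andP[x_ge0 x_le1]; elim: cs ds => [|a cs IH] ds /=; first exact: khintchine.
have := IH [:: a, a & ds]; rewrite !sumsq_cons => IHa.
have -> : sumsq ds + 2 * a ^+ 2 = a ^+ 2 + (a ^+ 2 + sumsq ds) by ring.
set phi := rademacher ds _ in IH IHa *.
have phiE : rademacher [:: a, a & ds] Num.norm
    = (fun u => 2^-1 * phi u
       + 4^-1 * (1 * phi (u + 2 * a) + 1 * phi (u + - (2 * a)))).
  apply/funext => u /=; rewrite -/phi subrK addrK.
  rewrite (_ : u + a + a = u + 2 * a); last by ring.
  rewrite (_ : u - a - a = u - 2 * a); last by ring.
  by field.
move: IHa; rewrite phiE lazy_walk_lin (lazy_walk_lin _ _ _ _ (fun u => phi (u + _))).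
rewrite !lazy_walk_shift => IHa.
have := ler_wpM2l x_ge0 IHa; have := ler_wpM2l (_ : 0 <= 1 - x) (IH ds).
by rewrite subr_ge0 => /(_ x_le1); rewrite -/phi; lra.
Qed.

Lemma sqrt_submodular s a b : 0 <= s -> 0 <= a -> 0 <= b ->
  Num.sqrt s + Num.sqrt (s + a + b) <= Num.sqrt (s + a) + Num.sqrt (s + b).
Proof.
move=> s_ge0 a_ge0 b_ge0.
have p1 : 0 <= s + a by rewrite addr_ge0.
have p2 : 0 <= s + b by rewrite addr_ge0.
have p3 : 0 <= s + a + b by rewrite !addr_ge0.
rewrite -(ler_pXn2r (n := 2)) ?nnegrE ?addr_ge0 ?sqrtr_ge0 //.
rewrite !sqrrD !sqr_sqrtr // -!sqrtrM //.
suff : Num.sqrt (s * (s + a + b)) <= Num.sqrt ((s + a) * (s + b)) by lra.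
by rewrite ler_sqrt ?mulr_ge0 //; have := mulr_ge0 a_ge0 b_ge0; lra.
Qed.

(** The square root is concave, so thinning the entries independently leaves a
    larger mean than keeping or dropping all of them together. *)
Lemma thinned_norm_ge x cs s : 0 <= x <= 1 -> 0 <= s ->
  ((1 - x) * Num.sqrt s + x * Num.sqrt (s + 2 * sumsq cs)) / Num.sqrt 2
  <= thinned_norm x cs s.
Proof.
move=> /andP[x_ge0 x_le1]; elim: cs s => [|a cs IH] s s_ge0 /=.
  rewrite sumsq_nil mulr0 addr0.
  by rewrite le_eqVlt; apply/orP; left; apply/eqP; ring.
have a_ge0 : 0 <= 2 * a ^+ 2 by rewrite mulr_ge0 ?sqr_ge0.
have A_ge0 : 0 <= 2 * sumsq cs by rewrite mulr_ge0 ?sumsq_ge0.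
have h1 := IH s s_ge0; have h2 := IH _ (addr_ge0 s_ge0 a_ge0).
have h3 := ler_wpM2l x_ge0 h2; have h4 := ler_wpM2l (_ : 0 <= 1 - x) h1.
move: h4; rewrite subr_ge0 => /(_ x_le1) h4.
apply: le_trans (lerD h4 h3).
rewrite sumsq_cons mulrDr addrA.
move: a_ge0 A_ge0; set p := 2 * a ^+ 2; set q := 2 * sumsq cs => a_ge0 A_ge0.
rewrite !mulrA -mulrDl ler_wpM2r ?invr_ge0 ?sqrtr_ge0 //.
have := sqrt_submodular s_ge0 a_ge0 A_ge0.
have : 0 <= x * (1 - x) by rewrite mulr_ge0 // subr_ge0.
move=> h5 /(ler_wpM2l h5).
by lra.
Qed.

Lemma sqrt2M s : 0 <= s -> Num.sqrt (2 * s) / Num.sqrt 2 = Num.sqrt s.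
Proof.
by move=> s_ge0; rewrite sqrtrM // mulrAC divff ?mul1r // sqrtr_eq0 -ltNge.
Qed.

(** The variance of a sign that is +1 with probability t. *)
Definition spread t : R := 4 * t * (1 - t).

Lemma spread_in01 t : 0 <= t <= 1 -> 0 <= spread t <= 1.
Proof.
rewrite /spread =>  /andP[t_ge0 t_le1]; have := sqr_ge0 (2 * t - 1).
have : 0 <= t * (1 - t) by rewrite mulr_ge0 // subr_ge0.
by move=> h1 h2; apply/andP; split; lra.
Qed.

Lemma self_distance_thinned t cs : 0 <= t <= 1 ->
  thinned_norm (spread t) cs 0 <= self_distance t cs.
Proof.
move=> /spread_in01 x01; have := lazy_walk_ge cs [::] x01.
rewrite sumsq_nil.
rewrite (_ : spread t / 2 = 2 * t * (1 - t)); last by rewrite /spread; field.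
rewrite -lazy_walkE; congr (_ <= _).
by congr expect; apply/funext => u; congr expect; apply/funext => v; rewrite add0r.
Qed.

Lemma self_distance_ge t cs : 0 <= t <= 1 ->
  spread t * Num.sqrt (sumsq cs) <= self_distance t cs.
Proof.
move=> t01; apply: le_trans (self_distance_thinned cs t01).
have := thinned_norm_ge cs (spread_in01 t01) (lexx 0).
by rewrite sqrtr0 mulr0 !add0r -(mulrA _ (Num.sqrt _)) sqrt2M ?sumsq_ge0.
Qed.

(** Thinning a separately from the block cs improves on [self_distance_ge] by a
    multiple of |a| + sqrt q - sqrt (a ^ 2 + q), with q = sumsq cs. *)
Lemma self_distance_two_blocks t a cs : 0 <= t <= 1 ->
  spread t * (1 - spread t) * (`|a| + Num.sqrt (sumsq cs))
    + spread t ^+ 2 * Num.sqrt (a ^+ 2 + sumsq cs)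
  <= self_distance t (a :: cs).
Proof.
move=> t01; apply: le_trans (self_distance_thinned _ t01).
set x := spread t; rewrite /= add0r.
have x01 : 0 <= x <= 1 := spread_in01 t01.
have [x_ge0 x_le1] := andP x01.
have a_ge0 : 0 <= 2 * a ^+ 2 by rewrite mulr_ge0 ?sqr_ge0.
have h1 := thinned_norm_ge cs x01 (lexx 0).
rewrite sqrtr0 mulr0 !add0r -(mulrA _ (Num.sqrt _)) sqrt2M ?sumsq_ge0 // in h1.
have h2 := thinned_norm_ge cs x01 a_ge0.
rewrite -mulrDr mulrDl -!(mulrA _ (Num.sqrt _)) !sqrt2M ?sqr_ge0 // in h2;
  last by rewrite addr_ge0 ?sqr_ge0 ?sumsq_ge0.
rewrite sqrtr_sqr in h2.
have h3 := ler_wpM2l x_ge0 h2; have h4 := ler_wpM2l (_ : 0 <= 1 - x) h1.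
move: h4; rewrite subr_ge0 => /(_ x_le1) h4.
by apply: le_trans (lerD h4 h3); lra.
Qed.

End Law.

(** * Integrals of polynomials over the unit interval *)

Section PolyIntegral.
Variable R : rcfType.
Implicit Types (p q : {poly R}) (t : R).

Definition pintegral p : R := \sum_(i < size p) p`_i / i.+1%:R.

Lemma pintegralE n p : (size p <= n)%N -> pintegral p = \sum_(i < n) p`_i / i.+1%:R.
Proof.
move=> le_p_n; rewrite /pintegral (big_ord_widen n (fun i => p`_i / i.+1%:R)) //.
rewrite big_mkcond; apply: eq_bigr => i _; case: ltnP => // /leq_sizeP -> //.
by rewrite mul0r.
Qed.

Lemma pintegral_lin a b p q :
  pintegral (a *: p + b *: q) = a * pintegral p + b * pintegral q.
Proof.
pose n := maxn (size p) (size q).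
have p_n : (size p <= n)%N by rewrite leq_maxl.
have q_n : (size q <= n)%N by rewrite leq_maxr.
have pq_n : (size (a *: p + b *: q)%R <= n)%N.
  rewrite (leq_trans (size_polyD _ _)) // geq_max.
  by rewrite !(leq_trans (size_scale_leq _ _)).
rewrite !(pintegralE p_n, pintegralE q_n, pintegralE pq_n) !mulr_sumr -big_split /=.
by apply: eq_bigr => i _; rewrite coefD !coefZ; ring.
Qed.

Lemma pintegral0 : pintegral 0 = 0.
Proof. by rewrite /pintegral size_poly0 big_ord0. Qed.

Lemma pintegralZ a p : pintegral (a *: p) = a * pintegral p.
Proof. by have := pintegral_lin a 0 p 0; rewrite pintegral0 scaler0 addr0 mulr0 addr0. Qed.

Lemma pintegralD p q : pintegral (p + q) = pintegral p + pintegral q.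
Proof. by have := pintegral_lin 1 1 p q; rewrite !scale1r !mul1r. Qed.

Lemma pintegralB p q : pintegral (p - q) = pintegral p - pintegral q.
Proof. by rewrite pintegralD -scaleN1r pintegralZ mulN1r. Qed.

Lemma pintegral_sum (I : finType) (P : pred I) (F : I -> {poly R}) :
  pintegral (\sum_(i | P i) F i) = \sum_(i | P i) pintegral (F i).
Proof. exact: (big_morph pintegral pintegralD pintegral0). Qed.

Lemma pintegralXn n : pintegral 'X^n = n.+1%:R^-1.
Proof.
rewrite (pintegralE (n := n.+1)) ?size_polyXn // (bigD1 ord_max) //= coefXn eqxx mul1r.
by rewrite big1 ?addr0 // => i; rewrite -val_eqE /= coefXn => /negPf ->; rewrite mul0r.
Qed.

Lemma pintegral_ge0 p : (forall t, 0 <= t <= 1 -> 0 <= p.[t]) -> 0 <= pintegral p.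
Proof.
move=> p_ge0; pose q := \poly_(i < (size p).+1) (p`_i.-1 / i%:R).
have dq : q^`() = p.
  apply/polyP => i; rewrite coef_deriv coef_poly ltnS /=.
  case: ltnP => [_|/leq_sizeP -> //]; last by rewrite mul0rn.
  by rewrite -[_ *+ i.+1]mulr_natr divfK ?pnatr_eq0.
have q0 : q.[0] = 0 by rewrite horner_coef0 coef_poly /= invr0 mulr0.
have q1 : q.[1] = pintegral p.
  rewrite horner_poly big_ord_recl /= expr1n invr0 mulr0 mul0r add0r.
  by apply: eq_bigr => i _; rewrite expr1n mulr1.
have [c /andP[c0 c1]] := poly_mvt q (@ltr01 R).
rewrite q0 q1 dq !subr0 mulr1 => ->.
by apply: p_ge0; rewrite !ltW.
Qed.

(** The probability that a uniformly random order of m + j + 1 items puts m given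
    items after, and the j others before, the remaining one. *)
Definition beta m j : R := m`!%:R * j`!%:R / (m + j).+1`!%:R.

Lemma factr_neq0 n : n`!%:R != 0 :> R.
Proof. by rewrite pnatr_eq0 -lt0n fact_gt0. Qed.

Lemma factSr n : n.+1`!%:R = n.+1%:R * n`!%:R :> R.
Proof. by rewrite factS natrM. Qed.

Lemma betaSr m j : (m + j.+1).+1%:R * beta m j.+1 = j.+1%:R * beta m j.
Proof.
rewrite /beta addnS (factSr (m + j).+1) (factSr j).
have cancel (N M J F G : R) : N != 0 -> G != 0 ->
    N * (M * (J * F) / (N * G)) = J * (M * F / G).
  by move=> N0 G0; field; rewrite N0 G0.
by rewrite cancel ?factr_neq0 ?pnatr_eq0.
Qed.

Lemma beta0r m : m.+1%:R * beta m 0 = 1.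
Proof.
by rewrite /beta addn0 mulr1 mulrA -factSr divff ?factr_neq0.
Qed.

Lemma beta_ge0 m j : 0 <= beta m j.
Proof. by rewrite divr_ge0 ?mulr_ge0 ?ler0n. Qed.

Lemma betaC m j : beta m j = beta j m.
Proof. by rewrite /beta addnC [m`!%:R * _]mulrC. Qed.

Lemma pintegral_beta m j : pintegral ('X^m * (1 - 'X) ^+ j) = beta m j.
Proof.
elim: j m => [|j IH] m.
  rewrite expr0 mulr1 pintegralXn; apply: (mulfI (_ : m.+1%:R != 0)).
    by rewrite pnatr_eq0.
  by rewrite beta0r divff ?pnatr_eq0.
have -> : 'X^m * (1 - 'X) ^+ j.+1
    = 'X^m * (1 - 'X) ^+ j - 'X^(m.+1) * (1 - 'X) ^+ j :> {poly R}.
  by rewrite [_ ^+ j.+1]exprS [_ ^+ m.+1]exprSr; ring.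
rewrite pintegralB !IH /beta addnS addSn (factSr (m + j).+1) !factSr.
have -> : (m.+1)%:R = m%:R + 1 :> R by rewrite -natr1.
have -> : (j.+1)%:R = j%:R + 1 :> R by rewrite -natr1.
have -> : (m + j).+2%:R = m%:R + j%:R + 2 :> R.
  by rewrite -natrD -addn2 natrD.
have -> : (m + j).+1%:R = m%:R + j%:R + 1 :> R by rewrite -natrD natr1.
have := factr_neq0 (m + j).
move: (m`!%:R) (j`!%:R) ((m + j)`!%:R) => a b c f0.
have h1 : m%:R + j%:R + 1 != 0 :> R by rewrite -natrD natr1 pnatr_eq0.
have h2 : m%:R + j%:R + 2 != 0 :> R by rewrite -natrD -natrD pnatr_eq0 addn2.
by field; rewrite f0 h1 h2.
Qed.

(** The integrals of the first two powers of 4 t (1 - t) are 2 / 3 and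
    8 / 15. *)
Lemma pintegral_spread_ge p c0 c1 c2 :
  (forall t, 0 <= t <= 1 -> c0 + c1 * spread t + c2 * spread t ^+ 2 <= p.[t]) ->
  c0 + c1 * (2 / 3) + c2 * (8 / 15) <= pintegral p.
Proof.
move=> le_p.
pose q : {poly R} := c0 *: ('X^0 * (1 - 'X) ^+ 0)
   + (c1 * 4) *: ('X^1 * (1 - 'X) ^+ 1) + (c2 * 16) *: ('X^2 * (1 - 'X) ^+ 2).
have qE t : q.[t] = c0 + c1 * spread t + c2 * spread t ^+ 2.
  rewrite /q /spread !(hornerD, hornerZ, hornerM, horner_exp, hornerXn).
  by rewrite !(hornerN, hornerX, hornerC); ring.
have -> : c0 + c1 * (2 / 3) + c2 * (8 / 15) = pintegral q.
  have e0 : beta 0 0 = 1 by rewrite /beta mulr1 divff ?factr_neq0.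
  have e1 : beta 1 1 = 1 / 6 by rewrite /beta (_ : (1 + 1).+1`! = 6)%N // mulr1.
  have e2 : beta 2 2 = 1 / 30.
    by rewrite /beta (_ : (2 + 2).+1`! = 120)%N // (_ : 2`! = 2)%N //; field.
  by rewrite !pintegralD !pintegralZ !pintegral_beta e0 e1 e2; field.
rewrite -subr_ge0 -pintegralB; apply: pintegral_ge0 => t /le_p.
by rewrite hornerD hornerN qE subr_ge0.
Qed.

End PolyIntegral.

(** * The Khintchine inequality averaged over the bias *)

Section Certificate.
Variable R : rcfType.
Implicit Types (t : R) (cs ds : seq R).

(** A lower bound for E_t|S| that is quadratic in the variance of the signs and
    whose integral over t is at least sqrt 2 / 3 times the norm.  The list
    [:: 1; -1] shows that sqrt 2 / 3 is optimal: E_t|S| is then exactly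
    spread t, of integral 2 / 3, and the norm is sqrt 2. *)
Definition certified cs : Prop := exists c0 c1 c2 : R,
  (forall t, 0 <= t <= 1 ->
     c0 + c1 * spread t + c2 * spread t ^+ 2 <= expect t cs Num.norm)
  /\ Num.sqrt 2 / 3 * Num.sqrt (sumsq cs) <= c0 + c1 * (2 / 3) + c2 * (8 / 15).

Lemma sumsq_cat cs ds : sumsq (cs ++ ds) = sumsq cs + sumsq ds.
Proof. exact: big_cat. Qed.

Lemma sumsqZ c cs : sumsq [seq c * a | a <- cs] = c ^+ 2 * sumsq cs.
Proof. by rewrite /sumsq big_map mulr_sumr; apply: eq_bigr => a _; rewrite exprMn. Qed.

Lemma certifiedZ c cs : certified cs -> certified [seq c * a | a <- cs].
Proof.
move=> [c0 [c1 [c2 [le_c le_s]]]]; exists (`|c| * c0), (`|c| * c1), (`|c| * c2).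
split=> [t t01|].
  rewrite expectZ; under eq_fun do rewrite normrM.
  rewrite /expect integZ.
  by have := ler_wpM2l (normr_ge0 c) (le_c t t01); rewrite /expect; lra.
rewrite sumsqZ sqrtrM ?sqr_ge0 // sqrtr_sqr.
by have := ler_wpM2l (normr_ge0 c) le_s; lra.
Qed.

Lemma sqrtM_le (x y z : R) : 0 <= z -> x * y <= z ^+ 2 -> 0 <= x ->
  Num.sqrt x * Num.sqrt y <= z.
Proof.
move=> z_ge0 le_xy x_ge0; rewrite -sqrtrM // -(ger0_norm z_ge0) -sqrtr_sqr.
by rewrite ler_sqrt ?sqr_ge0.
Qed.

(** Equality holds when j = p + q and one of p, q vanishes, which is the case of
    two blocks of equal weight. *)
Lemma balanced_sqrt_ineq (p q j : R) :
  0 <= p -> 0 <= q -> 0 <= j -> j <= p + q -> p <= j -> q <= j ->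
  5 * (Num.sqrt 2 * Num.sqrt (p + q + j))
  <= 5 * Num.sqrt j + (Num.sqrt p + Num.sqrt q) + 4 * Num.sqrt (p + q).
Proof.
move=> p_ge0 q_ge0 j_ge0 le_j le_p le_q.
pose eta := p + q - j.
have eta_ge0 : 0 <= eta by rewrite subr_ge0.
have pq_ge0 : 0 <= p + q by rewrite addr_ge0.
(* For a fixed sum p + q and both terms at most j, the sum of the square roots
   is least at the extreme pair {eta, j}. *)
have le_pq : Num.sqrt eta + Num.sqrt j <= Num.sqrt p + Num.sqrt q.
  rewrite -(ler_pXn2r (n := 2)) ?nnegrE ?addr_ge0 ?sqrtr_ge0 //.
  rewrite !sqrrD !sqr_sqrtr // -!sqrtrM //.
  suff : Num.sqrt (eta * j) <= Num.sqrt (p * q) by rewrite /eta; lra.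
  rewrite ler_sqrt ?mulr_ge0 // /eta.
  have := mulr_ge0 (_ : 0 <= j - p) (_ : 0 <= j - q).
  by rewrite !subr_ge0 => /(_ le_p le_q); lra.
apply: le_trans (_ : 6 * Num.sqrt j + Num.sqrt eta + 4 * Num.sqrt (p + q) <= _);
  last by lra.
have -> : 5 * (Num.sqrt 2 * Num.sqrt (p + q + j))
    = Num.sqrt 50 * Num.sqrt (p + q + j) :> R.
  rewrite (_ : 50 = 5 ^+ 2 * 2 :> R); last by ring.
  by rewrite sqrtrM ?sqr_ge0 // sqrtr_sqr ger0_norm // mulrA.
set y := Num.sqrt j; set h := Num.sqrt eta; set s := Num.sqrt (p + q).
have y_ge0 : 0 <= y by exact: sqrtr_ge0.
have h_ge0 : 0 <= h by exact: sqrtr_ge0.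
have s_ge0 : 0 <= s by exact: sqrtr_ge0.
have y2 : y ^+ 2 = j by rewrite sqr_sqrtr.
have h2 : h ^+ 2 = eta by rewrite sqr_sqrtr.
have s2 : s ^+ 2 = p + q by rewrite sqr_sqrtr.
have sE : s ^+ 2 = y ^+ 2 + h ^+ 2 by rewrite s2 y2 h2 /eta; ring.
have le_hy : h <= y by rewrite ler_sqrt // /eta; lra.
have le_ys : y <= s by rewrite ler_sqrt.
have le_s : s <= 3 / 2 * y.
  have y_ge0' : 0 <= 3 / 2 * y by lra.
  rewrite -(ler_pXn2r (n := 2)) ?nnegrE // exprMn.
  have : h ^+ 2 <= y ^+ 2 by rewrite ler_pXn2r.
  by have := sqr_ge0 y; rewrite sE; lra.
apply: sqrtM_le => //; first by rewrite !addr_ge0 ?mulr_ge0.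
rewrite -s2 -y2.
have k1 : 0 <= h * (y - h) by rewrite mulr_ge0 // subr_ge0.
have k2 : 0 <= h * (s - h) by rewrite mulr_ge0 // subr_ge0 (le_trans le_hy).
have k3 : 0 <= (s - y) * (3 / 2 * y - s) by rewrite mulr_ge0 // subr_ge0.
by nra.
Qed.

(** The energy inequality for the split of the list into a :: cs and ds.  With
    p + q = j it would suffice to use [self_distance_ge] on both sides; the
    heavier side a :: cs is treated in two blocks to make up for p + q > j. *)
Lemma certified_balanced a cs ds :
  let p := a ^+ 2 in let q := sumsq cs in let j := sumsq ds in
  j <= p + q -> p <= j -> q <= j -> certified (a :: cs ++ ds).
Proof.
move=> p q j le_j le_p le_q.
pose b := `|a| + Num.sqrt q; pose s := Num.sqrt (p + q); pose y := Num.sqrt j.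
exists 0, ((b + y) / 2), ((s - b) / 2); split=> [t t01|].
  apply: le_trans (energy_split t (a :: cs) ds).
  have := self_distance_two_blocks a cs t01; have := self_distance_ge ds t01.
  by rewrite -/q -/j -/p -/s -/y -/b; lra.
have p_ge0 : 0 <= p by exact: sqr_ge0.
have := balanced_sqrt_ineq p_ge0 (sumsq_ge0 cs) (sumsq_ge0 ds) le_j le_p le_q.
rewrite sumsq_cons sumsq_cat -/p -/q -/j (addrA p) -/y -/s sqrtr_sqr -/b.
by lra.
Qed.

(** The leading coefficient is 1.  With Q the sum over cs, kappa is the mean of
    the truncation of Q to [-1, 1], and rho is the mean of max(1, |Q|). *)
Section Dominant.
Variables (t : R) (cs : seq R).
Hypothesis t01 : 0 <= t <= 1.

Let clip u : R := (`|1 + u| - `|1 - u|) / 2.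
Let kappa : R := expect t cs clip.
Let rho : R := expect t cs (fun u => (`|1 + u| + `|1 - u|) / 2).

Lemma expect_one_cons : expect t (1 :: cs) Num.norm = rho + (2 * t - 1) * kappa.
Proof.
rewrite expect_cons /rho /kappa /expect -!integZ -!integD.
by congr integ; apply/funext => u; rewrite /clip -[`|- 1 + u|]normrN opprD opprK; field.
Qed.

Lemma rho_ge1 : 1 <= rho.
Proof.
rewrite -(expect_const t cs 1); apply: le_expect => // u.
by have := ler_norm (1 + u); have := ler_norm (1 - u); lra.
Qed.

(** The energy inequality between the law of - Q and a measure of mass 1 on
    {-1, 1}; the mean - kappa is the best choice for the latter. *)
Lemma rho_energy :
  (1 + kappa ^+ 2 + self_distance t cs) / 2 <= rho.
Proof.
pose m : seq (R * R) := [:: ((1 - kappa) / 2, 1); ((1 + kappa) / 2, -1)]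
  ++ [seq (-1 * d.1, - d.2) | d <- law t cs].
have integ_m phi : integ m phi
    = (1 - kappa) / 2 * phi 1 + (1 + kappa) / 2 * phi (-1)
      - expect t cs (fun u => phi (- u)).
  rewrite /m integ_cat integ_map !integ_cons [integ [::] _]big_nil /=.
  by rewrite addr0 mulN1r.
have m0 : mass m = 0 by rewrite /mass integ_m expect_const; field.
have := energy m0; rewrite integ_m !integ_m.
under [X in _ - expect _ _ X]eq_fun do rewrite integ_m.
have eD : expect t cs (fun u => `|1 - - u|) = rho + kappa.
  rewrite /rho /kappa /expect -integD; congr integ; apply/funext => u.
  by rewrite /clip opprK; field.
have eB : expect t cs (fun u => `|-1 - - u|) = rho - kappa.
  rewrite /rho /kappa /expect -[- integ _ _]mulN1r -integZ -integD.
  congr integ; apply/funext => u.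
  by rewrite /clip -[`|-1 - _|]normrN opprB opprK addrC; field.
rewrite eD eB.
have -> : expect t cs (fun u => (1 - kappa) / 2 * `|- u - 1|
      + (1 + kappa) / 2 * `|- u - -1| - expect t cs (fun v => `|- u - - v|))
    = (1 - kappa) / 2 * (rho + kappa) + (1 + kappa) / 2 * (rho - kappa)
      - self_distance t cs.
  rewrite -eD -eB /self_distance /expect -[- integ _ _ in RHS]mulN1r -!integZ -!integD.
  congr integ; apply/funext => u; rewrite mulN1r; congr (_ * _ + _ * _ - _).
  - by rewrite distrC.
  - by rewrite distrC.
  - by congr integ; apply/funext => v; rewrite -normrN opprB opprK addrC.
have n1 : `|-1 - 1| = 2 :> R by rewrite ler0_norm; lra.
have n2 : `|1 - -1| = 2 :> R by rewrite ger0_norm; lra.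
by rewrite !subrr !normr0 n1 n2; lra.
Qed.

End Dominant.

(** Average [rho_ge1] and [rho_energy] with weights 1 - k and k.  The result is
    quadratic in the unknown kappa, and completing the square bounds it below.
    With r the norm of cs, the choice k = (1 + r) / 2 is exact at r = 1, where
    [:: 1; -1] gives equality. *)
Lemma certified_dominant_large cs : 1 / 4 <= sumsq cs <= 1 ->
  certified (1 :: cs).
Proof.
move=> /andP[r_ge r_le]; pose r := Num.sqrt (sumsq cs).
have r2 : r ^+ 2 = sumsq cs by rewrite sqr_sqrtr ?sumsq_ge0.
have r_ge0 : 0 <= r by exact: sqrtr_ge0.
have r_half : 1 / 2 <= r.
  by rewrite -(ler_pXn2r (n := 2)) ?nnegrE ?divr_ge0 // r2; lra.
have r_le1 : r <= 1 by rewrite -(ler_pXn2r (n := 2)) ?nnegrE // r2 expr1n.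
pose k := (1 + r) / 2.
have k_gt0 : 0 < k by rewrite /k; lra.
have k_le1 : k <= 1 by rewrite /k; lra.
exists (1 - k / 2 - 1 / (2 * k)), (k * r / 2 + 1 / (2 * k)), 0; split=> [t t01|].
  rewrite expect_one_cons.
  have := rho_ge1 cs t01; have := rho_energy t cs.
  have := self_distance_ge cs t01; rewrite -/r.
  set kappa := expect _ _ _; set sd := self_distance _ _; set rho := expect _ _ _.
  move=> sd_ge rho_ge rho_ge1; set mu := 2 * t - 1.
  have spreadE : spread t = 1 - mu ^+ 2 by rewrite /spread /mu; ring.
  have kM := ler_wpM2l (ltW k_gt0) rho_ge.
  have kM2 := ler_wpM2l (ltW k_gt0) sd_ge.
  have kM1 : 0 <= (1 - k) * (rho - 1) by rewrite mulr_ge0 ?subr_ge0.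
  (* Completing the square in kappa. *)
  have sq : 0 <= (k * kappa + mu) ^+ 2 / (2 * k).
    by apply: divr_ge0; [apply: sqr_ge0|lra].
  have sqE : (k * kappa + mu) ^+ 2 / (2 * k)
      = k * kappa ^+ 2 / 2 + mu * kappa + mu ^+ 2 * (1 / (2 * k)).
    by field; rewrite gt_eqF.
  rewrite sqE in sq; rewrite spreadE in kM2 *.
  by move: (1 / (2 * k)) sq => i sq; lra.
rewrite sumsq_cons expr1n -r2 mul0r addr0.
have rE : r = 2 * k - 1 by rewrite /k; field.
set rhs := (X in _ <= X).
have rhsE : 3 * rhs = 3 - 5 / 2 * k + 2 * k ^+ 2 - 1 / (2 * k).
  by rewrite /rhs rE; field; rewrite gt_eqF.
pose d := 1 - r.
have rhs_ge : 2 - d + d ^+ 2 / 3 <= 3 * rhs.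
  have kE : 3 * rhs * k = 3 * k - 5 / 2 * k ^+ 2 + 2 * k ^+ 3 - 1 / 2.
    by rewrite rhsE; field; rewrite gt_eqF.
  have : 0 <= (k - 1) ^+ 2 * (k - 3 / 4).
    by rewrite mulr_ge0 ?sqr_ge0 // subr_ge0 /k; lra.
  move=> k_ineq; suff : (2 - d + d ^+ 2 / 3) * k <= 3 * rhs * k by rewrite ler_pM2r.
  by rewrite kE /d rE; lra.
have sq : Num.sqrt 2 * Num.sqrt (1 + r ^+ 2) <= 2 - d + d ^+ 2 / 3.
  have d_ineq : 0 <= d ^+ 2 * (1 / 2 - d).
    by rewrite mulr_ge0 ?sqr_ge0 // subr_ge0 /d; lra.
  have d4 := sqr_ge0 (d ^+ 2); have d2 := sqr_ge0 d.
  by apply: sqrtM_le => //; rewrite /d in d_ineq d4 d2 *; lra.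
by lra.
Qed.

(** Given the leading sign, Jensen's inequality replaces the rest of the sum by
    its mean - mu q, where mu = 2 t - 1.  For q < 1 the bound 1 - mu ^ 2 q
    suffices.  Otherwise average it with |mu| (q - 1) >= mu ^ 2 (q - 1), with
    weights 1 - 5 / 6 mu ^ 2 and 5 / 6 mu ^ 2: the factor 5 / 6 makes the
    coefficient of q integrate to 0, and 5 / 9 remains. *)
Lemma certified_dominant_small cs : sumsq cs <= 1 / 4 -> certified (1 :: cs).
Proof.
move=> r_le.
have target : Num.sqrt 2 / 3 * Num.sqrt (sumsq (1 :: cs)) <= 5 / 9.
  suff : Num.sqrt 2 * Num.sqrt (sumsq (1 :: cs)) <= 5 / 3 by lra.
  by apply: sqrtM_le; rewrite ?sumsq_cons ?expr1n; lra.
pose q := - \sum_(a <- cs) a.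
have norm_ge t : 0 <= t <= 1 -> let mu := 2 * t - 1 in
    [/\ 1 - mu ^+ 2 * q <= expect t (1 :: cs) Num.norm
      & `|mu * q| - `|mu| <= expect t (1 :: cs) Num.norm].
  move=> t01 mu; have [t_ge0 t_le1] := andP t01.
  have := jensen_norm cs 1 t01; have := jensen_norm cs (-1) t01.
  rewrite -/mu -[\sum_(a <- _) a]opprK -/q mulrN => h1 h2.
  have h3 := ler_wpM2l t_ge0 h2.
  have := ler_wpM2l (_ : 0 <= 1 - t) h1; rewrite subr_ge0 => /(_ t_le1) h4.
  have := lerD h3 h4; rewrite -expect_cons => h5.
  split; apply: le_trans h5.
    have := ler_norm (1 - mu * q); have := ler_norm (- (- 1 - mu * q)).
    rewrite normrN => h6 h7.
    have := ler_wpM2l t_ge0 h7; have := ler_wpM2l (_ : 0 <= 1 - t) h6.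
    by rewrite subr_ge0 => /(_ t_le1); rewrite /mu; lra.
  have [mq_ge0|mq_lt0] := ger0P (mu * q).
    have := ler_norm (- (1 - mu * q)); have := ler_norm (- (- 1 - mu * q)).
    rewrite !normrN => h6 h7; have h8 := ler_norm mu.
    have := ler_wpM2l t_ge0 h7; have := ler_wpM2l (_ : 0 <= 1 - t) h6.
    by rewrite subr_ge0 => /(_ t_le1); rewrite /mu in h8 *; lra.
  have := ler_norm (1 - mu * q); have := ler_norm (- 1 - mu * q).
  move=> h6 h7; have := ler_norm (- mu); rewrite normrN => h8.
  have := ler_wpM2l t_ge0 h7; have := ler_wpM2l (_ : 0 <= 1 - t) h6.
  by rewrite subr_ge0 => /(_ t_le1); rewrite /mu in h8 *; lra.
have [q_lt1|q_ge1] := ltrP q 1.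
  exists 0, 1, 0; split=> [t t01|]; last by lra.
  have [+ _] := norm_ge t t01; apply: le_trans.
  have := sqr_ge0 (2 * t - 1); have := ltW q_lt1.
  by rewrite /spread; nra.
exists (2 / 3 * q - 2 / 3), (5 / 2 - 7 / 3 * q), (5 / 3 * q - 5 / 6).
split=> [t t01|]; last by lra.
have [ge1 ge2] := norm_ge t t01; set mu := 2 * t - 1 in ge1 ge2.
have spreadE : spread t = 1 - mu ^+ 2 by rewrite /spread /mu; ring.
have mu_le1 : `|mu| <= 1.
  by case/andP: t01 => ? ?; rewrite ler_norml /mu; apply/andP; split; lra.
have mu2 : mu ^+ 2 = `|mu| ^+ 2 by rewrite real_normK ?num_real.
have mu2_le : mu ^+ 2 <= `|mu|.
  by rewrite mu2 expr2 -[leRHS]mulr1 ler_wpM2l.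
move: ge1 ge2; set N := expect _ _ _ => ge1.
rewrite normrM (ger0_norm (le_trans ler01 q_ge1)) => ge2.
have ge3 : mu ^+ 2 * (q - 1) <= N.
  apply: le_trans ge2; rewrite -[X in _ <= _ - X]mulr1 -mulrBr.
  by rewrite ler_wpM2r // subr_ge0.
have m_ge0 : 0 <= 5 / 6 * mu ^+ 2 by rewrite mulr_ge0 ?sqr_ge0 //; lra.
have m_le1 : 0 <= 1 - 5 / 6 * mu ^+ 2 by lra.
have := ler_wpM2l m_ge0 ge3; have := ler_wpM2l m_le1 ge1.
by rewrite spreadE; lra.
Qed.

Lemma certified_dominant a cs : a != 0 -> sumsq cs <= a ^+ 2 -> certified (a :: cs).
Proof.
move=> a0 le_a.
have -> : a :: cs = [seq a * b | b <- 1 :: [seq a^-1 * b | b <- cs]].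
  rewrite /= mulr1 -map_comp; congr cons.
  by rewrite -[LHS]map_id; apply: eq_map => b /=; rewrite mulVKf.
apply: certifiedZ.
have le1 : sumsq [seq a^-1 * b | b <- cs] <= 1.
  by rewrite sumsqZ exprVn mulrC ler_pdivrMr ?mul1r ?exprn_even_gt0.
have [le_s|/ltW ge_s] := lerP (sumsq [seq a^-1 * b | b <- cs]) (1 / 4).
  exact: certified_dominant_small.
by apply: certified_dominant_large; rewrite ge_s.
Qed.

End Certificate.

(** * Random subsets *)

Section Subsets.
Import mathcomp.boot.fintype mathcomp.boot.finset.
Variables (R : rcfType) (T : finType).
Implicit Types (D X Y : {set T}) (a : T -> R).

Lemma sum_subsetsU1 x D (G : {set T} -> R) : x \notin D ->
  \sum_(X : {set T} | X \subset x |: D) G X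
  = \sum_(X : {set T} | X \subset D) (G X + G (x |: X)).
Proof.
move=> xD; rewrite big_split /= (bigID (fun X : {set T} => x \in X)) /= addrC.
congr (_ + _).
  apply: eq_bigl => X; apply/andP/idP => [[sX xX]|sX].
    by apply/subsetP => y yX; have := subsetP sX y yX; rewrite !inE;
       case: eqP => // y_x; rewrite y_x (negPf xX) in yX.
  split; first by rewrite (fintype.subset_trans sX) ?subsetUr.
  by apply: contra xD; apply: subsetP.
rewrite (reindex_onto (fun X => x |: X) (fun X => X :\ x)) /=; last first.
  by move=> X /andP[_ xX]; rewrite setD1K.
apply: eq_bigl => X; rewrite setU11 andbT.
apply/andP/idP => [[sX /eqP eX]|sX].
  have xX : x \notin X by rewrite -eX !inE eqxx.
  apply/subsetP => y yX; have := subsetP sX y; rewrite !inE yX orbT => /(_ isT).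
  by case: eqP => // y_x; rewrite y_x (negPf xX) in yX.
split; first by rewrite setUS.
by rewrite setU1K //; apply: contra xD; apply: subsetP.
Qed.

Lemma expect_subsets t s a (phi : R -> R) : uniq s ->
  \sum_(X : {set T} | X \subset [set x in s])
     t ^+ #|X| * (1 - t) ^+ #|[set x in s] :\: X|
     * phi (\sum_(i in X) a i - \sum_(i in [set x in s] :\: X) a i)
  = expect t [seq a i | i <- s] phi.
Proof.
elim: s phi => [|x s IH] phi /=.
  move=> _; rewrite (_ : [set x in [::]] = set0); last first.
    by apply/setP => y; rewrite !inE.
  rewrite (eq_bigl (pred1 set0)) => [|X]; last exact: subset0.
  by rewrite big_pred1_eq expect_nil setD0 !cards0 !big_set0 subrr !mul1r.
move=> /andP[x_s uniq_s]; rewrite expect_cons -!IH //.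
set D := [set y in s]; have xD : x \notin D by rewrite inE.
have -> : [set y in x :: s] = x |: D by apply/setP => y; rewrite !inE.
rewrite sum_subsetsU1 // big_split /= addrC !mulr_sumr.
congr (_ + _); apply: eq_bigr => X sX; have xX := contra (subsetP sX x) xD.
  have -> : (x |: D) :\: (x |: X) = D :\: X.
    apply/setP => y; rewrite !inE; case: eqP => //= ->.
    by rewrite (negPf x_s) andbF.
  by rewrite cardsU1 xX exprS !big_setU1 // addrA -!mulrA.
have -> : (x |: D) :\: X = x |: (D :\: X).
  by apply/setP => y; rewrite !inE; case: eqP => //= ->; rewrite xX.
have xDX : x \notin D :\: X by rewrite !inE (negPf x_s) andbF.
rewrite cardsU1 xDX exprS big_setU1 // opprD addrCA.
by rewrite !mulrA; congr (_ * _ * _); rewrite mulrC.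
Qed.

Definition sqnorm a X : R := \sum_(i in X) a i ^+ 2.

Lemma sqnorm_enum a X : sumsq [seq a i | i <- enum X] = sqnorm a X.
Proof. by rewrite /sumsq big_map big_enum. Qed.

Lemma sqnormU1 a b X : b \notin X -> sqnorm a (b |: X) = a b ^+ 2 + sqnorm a X.
Proof. by move=> bX; rewrite /sqnorm big_setU1. Qed.

Lemma sqnormD1 a b X : b \in X -> sqnorm a X = a b ^+ 2 + sqnorm a (X :\ b).
Proof. by move=> bX; rewrite /sqnorm (big_setD1 b). Qed.

Lemma optimal_split a D : exists X : {set T},
  [/\ X \subset D, sqnorm a (D :\: X) <= sqnorm a X
    & forall Y, Y \subset D ->
        sqnorm a X - sqnorm a (D :\: X) <= `|sqnorm a Y - sqnorm a (D :\: Y)| ].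
Proof.
pose gap X := `|sqnorm a X - sqnorm a (D :\: X)|.
have [X sX X_min] := @Order.TotalTheory.arg_minP _ _ _ set0
  (fun X => X \subset D) gap (sub0set D).
have [le_X|lt_X] := lerP (sqnorm a (D :\: X)) (sqnorm a X).
  exists X; split=> // Y /X_min; apply: le_trans; exact: ler_norm.
exists (D :\: X).
have DDX : D :\: (D :\: X) = X by rewrite setDDr setDv set0U (setIidPr sX).
rewrite DDX subsetDl ltW //; split=> // Y /X_min; apply: le_trans.
by rewrite /gap distrC ler_norm.
Qed.

(** Take a split of D that is as balanced as possible, with heavier side X.
    Moving a nonzero coefficient b from X to the other side cannot improve the
    balance, so what it leaves in X weighs at most the other side.  Hence either
    [certified_balanced] applies, or b is the only nonzero coefficient in X and
    dominates all the others. *)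
Lemma certified_enum a D : exists s : seq T,
  [/\ uniq s, s =i D & certified [seq a i | i <- s]].
Proof.
have [X [sX le_jX X_min]] := optimal_split a D.
set j := sqnorm a (D :\: X) in le_jX X_min.
have remove b : b \in X -> a b != 0 -> sqnorm a (X :\ b) <= j.
  move=> bX ab0; have := X_min (X :\ b) (subset_trans (subsetDl _ _) sX).
  have -> : D :\: (X :\ b) = b |: (D :\: X).
    apply/setP => y; rewrite !inE; case: eqP => //= -> /=.
    by rewrite (subsetP sX).
  rewrite sqnormU1 ?inE ?bX // -/j (sqnormD1 _ bX).
  have ab : 0 < a b ^+ 2 by rewrite exprn_even_gt0.
  have [_|_] := ger0P (sqnorm a (X :\ b) - (a b ^+ 2 + j)); lra.
have sq_ge0 Y : 0 <= sqnorm a Y by apply: sumr_ge0 => i _; apply: sqr_ge0.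
have [/existsP[b /andP[bX ab0]]|noX] :=
  boolP [exists b, (b \in X) && (a b != 0)]; last first.
  exists (enum D); split; first exact: enum_uniq.
    by move=> y; rewrite mem_enum.
  exists 0, 0, 0; split=> [t t01|].
    rewrite !mul0r !addr0 -(expect_const t [seq a i | i <- enum D] 0).
    exact: le_expect.
  rewrite sqnorm_enum !mul0r !addr0.
  have X0 : sqnorm a X = 0.
    rewrite /sqnorm big1 // => i iX; apply/eqP; rewrite sqrf_eq0.
    by have := existsPn noX i; rewrite iX /= negbK.
  have -> : sqnorm a D = 0.
    have -> : sqnorm a D = sqnorm a X + j.
      by rewrite /sqnorm (big_setID X) /= (setIidPr sX).
    have := sq_ge0 (D :\: X); rewrite -/j; lra.
  by rewrite sqrtr0 mulr0.
exists (b :: enum (X :\ b) ++ enum (D :\: X)); split.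
- rewrite /= mem_cat !mem_enum !inE eqxx bX /= cat_uniq !enum_uniq /= andbT.
  by apply/hasPn => y; rewrite !mem_enum !inE => /andP[/negPf -> _]; rewrite andbF.
- move=> y; rewrite inE mem_cat !mem_enum !inE.
  case: eqP => [->|_] /=; first by rewrite (subsetP sX).
  by case yX: (y \in X) => //=; rewrite (subsetP sX).
rewrite /= map_cat.
have XE := sqnormD1 a bX.
have le_q := remove b bX ab0.
have [le_pj|lt_jp] := lerP (a b ^+ 2) j.
  by apply: certified_balanced; rewrite !sqnorm_enum -?XE.
apply: certified_dominant => //; rewrite sumsq_cat !sqnorm_enum -/j.
suff -> : sqnorm a (X :\ b) = 0 by rewrite add0r ltW.
apply: big1 => c; rewrite !inE => /andP[cb cX]; apply/eqP; rewrite sqrf_eq0.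
apply/negPn/negP => ac0; have := remove c cX ac0.
rewrite (@sqnormD1 a b) ?inE 1?eq_sym ?cb //.
by have := sq_ge0 (X :\ c :\ b); lra.
Qed.

(** The mean of |sum of a over X| for a random subset X of D that keeps each
    element with probability t, with t itself uniform in [0, 1]. *)
Definition mean_imbalance a D : R :=
  \sum_(X : {set T} | X \subset D) beta R #|X| #|D :\: X| * `|\sum_(i in X) a i|.

Lemma sum_subsets_compl D (G : {set T} -> R) :
  \sum_(X : {set T} | X \subset D) G X = \sum_(X : {set T} | X \subset D) G (D :\: X).
Proof.
rewrite (reindex_onto (fun X => D :\: X) (fun X => D :\: X)) /=; last first.
  by move=> X sX; rewrite setDDr setDv set0U (setIidPr sX).
apply: eq_bigl => X; rewrite subsetDl /=; apply/eqP/idP => [<-|sX].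
  exact: subsetDl.
by rewrite setDDr setDv set0U (setIidPr sX).
Qed.

(** X and its complement in D have the same law, and the mean of the two
    absolute values is at least half the absolute value of the difference, which
    is a sum of signs times the a i. *)
Lemma mean_imbalance_ge a D :
  Num.sqrt 2 / 6 * Num.sqrt (sqnorm a D) <= mean_imbalance a D.
Proof.
pose G X := `|\sum_(i in X) a i - \sum_(i in D :\: X) a i|.
have half : \sum_(X : {set T} | X \subset D) beta R #|X| #|D :\: X| * G X
            <= 2 * mean_imbalance a D.
  have flip : mean_imbalance a D = \sum_(X : {set T} | X \subset D)
      beta R #|X| #|D :\: X| * `|\sum_(i in D :\: X) a i|.
    rewrite /mean_imbalance sum_subsets_compl; apply: eq_bigr => X sX.
    by rewrite setDDr setDv set0U (setIidPr sX) betaC.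
  rewrite mulr_natl mulr2n {2}flip -big_split /=; apply: ler_sum => X _.
  by rewrite -mulrDr ler_wpM2l ?beta_ge0 ?ler_normB.
suff : Num.sqrt 2 / 3 * Num.sqrt (sqnorm a D)
    <= \sum_(X : {set T} | X \subset D) beta R #|X| #|D :\: X| * G X by lra.
have [s [uniq_s sD [c0 [c1 [c2 [le_c le_sq]]]]]] := certified_enum a D.
have sE : [set x in s] = D by apply/setP => y; rewrite inE sD.
have -> : sqnorm a D = sumsq [seq a i | i <- s].
  rewrite -sqnorm_enum; apply: perm_big; apply: perm_map.
  by apply: uniq_perm; rewrite ?enum_uniq // => y; rewrite mem_enum sD.
apply: le_trans le_sq _.
pose p : {poly R} := \sum_(X : {set T} | X \subset D)
  G X *: ('X^#|X| * (1 - 'X) ^+ #|D :\: X|).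
have -> : \sum_(X : {set T} | X \subset D) beta R #|X| #|D :\: X| * G X = pintegral p.
  by rewrite pintegral_sum; apply: eq_bigr => X _; rewrite pintegralZ pintegral_beta mulrC.
apply: pintegral_spread_ge => t /le_c; congr (_ <= _).
rewrite -expect_subsets // sE horner_sum; apply: eq_bigr => X _.
by rewrite !(hornerZ, hornerM, horner_exp, hornerD, hornerN, hornerX, hornerC) mulrC.
Qed.

End Subsets.

(** * Orderings built greedily from their two ends *)

Section Greedy.
Variables (R : rcfType) (V : finType).
Import mathcomp.boot.fintype mathcomp.boot.finset.
Implicit Types (D W X : {set V}) (s : seq V).

(** Order D and one more element v at random and let X be the part of D after
    v.  Either v comes first and X = D, or the first element is some u in D, and
    X is distributed as for D without u. *)
Lemma mean_imbalance_rec (b : V -> R) D :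
  #|D|.+1%:R * mean_imbalance b D
  = `|\sum_(i in D) b i| + \sum_(u in D) mean_imbalance b (D :\ u).
Proof.
rewrite /mean_imbalance mulr_sumr.
have -> : \sum_(u in D) \sum_(X : {set V} | X \subset D :\ u)
      beta R #|X| #|(D :\ u) :\: X| * `|\sum_(i in X) b i|
    = \sum_(X : {set V} | X \subset D) \sum_(u in D :\: X)
        beta R #|X| #|D :\: X|.-1 * `|\sum_(i in X) b i|.
  rewrite (exchange_big_dep (fun X : {set V} => X \subset D)) /=; last first.
    by move=> u X _ sX; apply: subset_trans sX (subsetDl _ _).
  apply: eq_bigr => X sX; apply: congr_big => // [u|u /andP[uD suX]].
    by rewrite subsetD1 sX inE andbC.
  rewrite setDDl setUC -setDDl (cardsD1 u (D :\: X)) inE uD.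
  by move: suX; rewrite subsetD1 => /andP[_ ->].
rewrite (bigD1 D) //= [in RHS](bigD1 D) //= setDv cards0 big_set0 add0r.
rewrite mulrA beta0r mul1r; congr (_ + _).
apply: eq_bigr => X /andP[sX neqX]; rewrite sumr_const -[RHS]mulr_natl [LHS]mulrA [RHS]mulrA.
congr (_ * _).
have cardD : #|D| = (#|X| + #|D :\: X|)%N by rewrite -(cardsID X D) (setIidPr sX).
rewrite cardD; case cardDX : #|D :\: X| => [|j]; last exact: betaSr.
move/eqP: cardDX; rewrite cards_eq0 setD_eq0 => sDX.
by rewrite eqEsubset sX sDX in neqX.
Qed.

Variable a : V -> V -> R.
Hypothesis a_anti : forall u v, a v u = - a u v.

Fixpoint order_gain s : R :=
  if s is v :: s' then \sum_(u <- s') a v u + order_gain s' else 0.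

Lemma order_gain_rcons s v :
  order_gain (rcons s v) = order_gain s - \sum_(u <- s) a v u.
Proof.
elim: s => [|x s IH] /=; first by rewrite !big_nil addr0 subr0.
rewrite IH -cats1 big_cat big_cons big_nil big_cons /= (a_anti v x); ring.
Qed.

(** The mean gain of the greedy construction on W when the vertices are taken in
    a uniformly random order. *)
Definition greedy_value W : R := \sum_(v in W) mean_imbalance (a v) (W :\ v).

Lemma greedy_value_rec W :
  #|W|%:R * greedy_value W
  = \sum_(v in W) (`|\sum_(u in W :\ v) a v u| + greedy_value (W :\ v)).
Proof.
rewrite big_split /= mulr_sumr.
have -> : \sum_(v in W) greedy_value (W :\ v)
    = \sum_(v in W) \sum_(u in W :\ v) mean_imbalance (a v) (W :\ v :\ u).
  rewrite /greedy_value (exchange_big_dep (fun u => u \in W)) /=; last first.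
    by move=> v u _; rewrite !inE => /andP[].
  apply: eq_bigr => v vW; apply: congr_big => // [u|u _].
    by rewrite !inE vW andbT eq_sym andbC.
  by rewrite setDDl setUC -setDDl.
rewrite -big_split /=; apply: eq_bigr => v vW.
by rewrite -mean_imbalance_rec (cardsD1 v W) vW.
Qed.

(** Some v does at least as well as the mean over the first vertex taken.  Put it
    in front of an ordering of the others if its net weight towards them is
    nonnegative, and behind otherwise. *)
Lemma greedy_order W : exists s,
  [/\ uniq s, s =i W & greedy_value W <= order_gain s].
Proof.
have [n] := ubnP #|W|; elim: n W => // n IH W lt_W.
have [->|/set0Pn[v0 v0W]] := eqVneq W set0.
  exists [::]; split=> // [v|]; first by rewrite inE.
  by rewrite /greedy_value big_set0.
have [v vW le_v] : exists2 v, v \in W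
    & greedy_value W <= `|\sum_(u in W :\ v) a v u| + greedy_value (W :\ v).
  apply/exists_inP; apply: contraT => /exists_inPn lt_v.
  have := ltxx (#|W|%:R * greedy_value W); rewrite {1}greedy_value_rec.
  rewrite mulr_natl -sumr_const ltr_sum // => [|v vW]; last first.
    by rewrite ltNge lt_v.
  by apply/hasP; exists v0; rewrite ?mem_index_enum.
have [|s [uniq_s sW le_s]] := IH (W :\ v).
  by move: lt_W; rewrite (cardsD1 v W) vW.
have vs : v \notin s by rewrite sW !inE eqxx.
have sumE : \sum_(u in W :\ v) a v u = \sum_(u <- s) a v u.
  rewrite -big_enum; apply: perm_big; apply: uniq_perm; rewrite ?enum_uniq //.
  by move=> u; rewrite mem_enum sW.
have vsW : v :: s =i W.
  by move=> u; rewrite inE sW !inE; case: eqP => // ->.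
move: le_v; rewrite sumE; have [_|_] := ger0P (\sum_(u <- s) a v u) => le_v.
  by exists (v :: s); split; rewrite /= ?vs //; lra.
exists (rcons s v); split; first by rewrite rcons_uniq vs.
  by move=> u; rewrite mem_rcons vsW.
by rewrite order_gain_rcons; lra.
Qed.

Lemma order_gainE s : uniq s ->
  order_gain s
  = \sum_(u <- s) \sum_(v <- s | (index u s < index v s)%N) a u v.
Proof.
elim: s => [|x s IH] /=; first by rewrite big_nil.
move=> /andP[xs /IH ->]; rewrite big_cons; congr (_ + _).
  rewrite big_cons eqxx /= big_seq [RHS]big_seq_cond.
  apply: eq_bigl => v; case vs: (v \in s) => //=.
  by case: eqP => // x_v; rewrite x_v vs in xs.
apply: eq_big_seq => u us; rewrite big_cons eqxx ltn0.
have xu : (x == u) = false by apply: contraNF xs => /eqP ->.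
rewrite big_seq_cond [RHS]big_seq_cond; apply: eq_bigl => v.
case vs: (v \in s) => //=.
have xv : (x == v) = false by apply: contraNF xs => /eqP ->.
by rewrite xu xv.
Qed.

End Greedy.

(** * Weighted oriented graphs *)

Section Digraphs.
Import mathcomp.boot.fintype mathcomp.boot.finset.
Variables (R : realType) (V : finType) (A : {set V * V}) (w : V * V -> R).
Implicit Types (v : V) (s : seq V) (e : V * V) (S F : {set V * V}).

Definition arcw x y : R := if (x, y) \in A then w (x, y) else 0.
Definition net x y : R := arcw x y - arcw y x.

Lemma sum_arcs (P : pred (V * V)) (f : R -> R) : f 0 = 0 ->
  \sum_(e in A | P e) f (w e)
  = \sum_x \sum_(y | P (x, y)) f (arcw x y).
Proof.
move=> f0; rewrite pair_big_dep /= big_mkcondl /=.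
by apply: eq_big => [[x y]|[x y] _] //=; rewrite /arcw; case: ifP.
Qed.

Lemma fwd_back_gain s : is_ordering s ->
  weight w (fwd A s) - weight w (back A s) = order_gain net s.
Proof.
move=> s_ord; have uniq_s : uniq s by rewrite (perm_uniq s_ord) enum_uniq.
rewrite order_gainE // (perm_big _ s_ord) big_enum /=.
under [RHS]eq_bigr do rewrite (perm_big _ s_ord) big_enum_cond sumrB.
rewrite sumrB /=; congr (_ - _).
  transitivity (\sum_(e in A | (index e.1 s < index e.2 s)%N) w e).
    by apply: eq_bigl => e; rewrite inE.
  exact: (sum_arcs (fun e => (index e.1 s < index e.2 s)%N) (f := id)).
transitivity (\sum_(e in A | (index e.2 s < index e.1 s)%N) w e).
  by apply: eq_bigl => e; rewrite inE.
rewrite (sum_arcs (fun e => (index e.2 s < index e.1 s)%N) (f := id)) //=.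
by rewrite (exchange_big_dep xpredT).
Qed.

Lemma fwdD_back s : oriented A -> is_ordering s -> A :\: back A s = fwd A s.
Proof.
move=> [noloop _] s_ord; apply/setP => -[x y]; rewrite !inE /=.
case xyA: ((x, y) \in A); rewrite ?andbF //= andbT -leqNgt leq_eqVlt.
case: eqP => // exy.
have mem_s z : z \in s by rewrite (perm_mem s_ord) mem_enum.
have x_y : x = y by apply: (index_inj x) exy.
by move: xyA (noloop x); rewrite -x_y => ->.
Qed.

Lemma back_feedback s : oriented A -> is_ordering s ->
  feedback_arc_set A (back A s).
Proof.
move=> A_or s_ord; split; first by apply/subsetP => e; rewrite inE => /andP[].
rewrite fwdD_back // => -[//|x c] /andP[/= c_cycle _].
have c_path : path (fun u v => (index u s < index v s)%N) x (rcons c x).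
  apply: sub_path c_cycle => u v /=; rewrite inE => /andP[_ //].
have trans : transitive (fun u v => (index u s < index v s)%N).
  by move=> v u z; apply: ltn_trans.
have /allP := order_path_min trans c_path.
by move=> /(_ x); rewrite mem_rcons mem_head ltnn => /(_ isT).
Qed.

Lemma weight_setD S F : F \subset S -> weight w (S :\: F) = weight w S - weight w F.
Proof.
by move=> sFS; rewrite /weight [in RHS](big_setID F) /= (setIidPr sFS) addrAC subrr add0r.
Qed.

Lemma weight_fwd s : oriented A -> is_ordering s ->
  weight w (fwd A s) = weight w A - weight w (back A s).
Proof.
move=> A_or s_ord; rewrite -fwdD_back // weight_setD //.
by case: (back_feedback A_or s_ord).
Qed.

Lemma fas_le F : feedback_arc_set A F -> fas A w <= weight w F.
Proof. by move=> fF; apply: Order.TotalTheory.bigmin_le_cond; apply/asboolP. Qed.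

Lemma incident_arcs v : oriented A -> forall f : R -> R, f 0 = 0 ->
  \sum_(e in A | incident v e) f (w e)
  = \sum_(u | u != v) (f (arcw v u) + f (arcw u v)).
Proof.
move=> [noloop _] f f0; have loop x : f (arcw x x) = 0.
  by rewrite /arcw (negPf (noloop x)).
rewrite sum_arcs // (bigD1 v) //= big_split /=; congr (_ + _).
  rewrite (eq_bigl xpredT) => [|y]; last by rewrite /incident eqxx.
  by rewrite (bigD1 v) //= loop add0r.
apply: eq_bigr => x /negPf x_v; rewrite (eq_bigl (pred1 v)) ?big_pred1_eq //.
by move=> y; rewrite /incident /= x_v.
Qed.

Lemma w2E v : oriented A ->
  w2 A w v = Num.sqrt (sqnorm (net v) ([set: V] :\ v)).
Proof.
move=> A_or; rewrite /w2 (incident_arcs v A_or (f := fun c => c ^+ 2)) ?expr0n //.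
congr Num.sqrt; apply: eq_big => [u|u _]; first by rewrite !inE andbT.
(* At most one of vu and uv is an arc, so the mixed term of the square is 0. *)
rewrite /net /arcw; have [_ /(_ v u)] := A_or.
by case: ifP => [vu /(_ isT)/negPf -> | _ _]; [ring | case: ifP => _; ring].
Qed.

Lemma main_ordering : oriented A -> exists s, is_ordering s
  /\ Num.sqrt 2 / 6 * \sum_v w2 A w v
     <= weight w (fwd A s) - weight w (back A s).
Proof.
move=> A_or.
have net_anti u v : net v u = - net u v by rewrite /net opprB.
have [s [uniq_s sT le_s]] := greedy_order net_anti [set: V].
have s_ord : is_ordering s.
  by apply: uniq_perm; rewrite ?enum_uniq // => v; rewrite sT mem_enum inE.
exists s; split=> //; rewrite fwd_back_gain //; apply: le_trans le_s.
rewrite mulr_sumr /greedy_value big_set /=.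
by apply: ler_sum => v _; rewrite w2E //; apply: mean_imbalance_ge.
Qed.

(** Cauchy-Schwarz against the constant function 1. *)
Lemma sum_sqr_le (I : finType) (P : pred I) (f : I -> R) :
  (\sum_(i | P i) f i) ^+ 2 <= #|P|%:R * \sum_(i | P i) f i ^+ 2.
Proof.
set n : R := #|P|%:R; set s := \sum_(i | P i) f i; set q := \sum_(i | P i) _.
have [n0|n_gt0] := posnP #|P|.
  have P0 i : P i = false by apply: (card0_eq n0 i).
  by rewrite /s /q !big_pred0 // expr0n mulr0.
have n_pos : 0 < n by rewrite ltr0n.
have := sumr_ge0 (index_enum I) (fun i (_ : P i) => sqr_ge0 (n * f i - s)).
have -> : \sum_(i | P i) (n * f i - s) ^+ 2 = n * (n * q - s ^+ 2).
  rewrite (eq_bigr (fun i => n ^+ 2 * f i ^+ 2 - 2 * n * s * f i + s ^+ 2)).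
    by rewrite big_split /= sumrB -!mulr_sumr sumr_const -mulr_natl -/n -/s -/q; ring.
  by move=> i _; ring.
by rewrite pmulr_rge0 // subr_ge0.
Qed.

Lemma card_incident v : (#|[pred e in A | incident v e]| <= maxdeg A)%N.
Proof.
apply: leq_trans (leq_bigmax v); rewrite /deg /outdeg /indeg.
apply: leq_trans (leq_card_setU _ _); apply: subset_leq_card.
by apply/subsetP => e; rewrite !inE => /andP[->].
Qed.

Lemma w2_ge v : weighting A w ->
  \sum_(e in A | incident v e) w e <= Num.sqrt (maxdeg A)%:R * w2 A w v.
Proof.
move=> w_ge0; set s := \sum_(e in A | _) _.
have s_ge0 : 0 <= s by apply: sumr_ge0 => e /andP[/w_ge0].
rewrite /w2 -sqrtrM ?ler0n // -(ger0_norm s_ge0) -sqrtr_sqr.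
have q_ge0 : 0 <= \sum_(e in A | incident v e) w e ^+ 2.
  by apply: sumr_ge0 => e _; apply: sqr_ge0.
rewrite ler_sqrt ?mulr_ge0 //; apply: le_trans (sum_sqr_le _ _) _.
by rewrite ler_wpM2r // ler_nat; apply: card_incident.
Qed.

Lemma sum_incident : oriented A ->
  \sum_v \sum_(e in A | incident v e) w e = 2 * weight w A.
Proof.
move=> [noloop _]; rewrite (exchange_big_dep (fun e => e \in A)) /=; last first.
  by move=> v e _ /andP[].
rewrite /weight mulr_sumr; apply: eq_bigr => -[x y] xyA.
have yx : y != x by apply: contraTneq xyA => ->; apply: noloop.
rewrite (eq_bigl (fun v => (x == v) || (y == v))) => [|v]; last first.
  by rewrite xyA.
rewrite (bigD1 x) ?eqxx //= (bigD1 y) /= ?eqxx ?orbT //.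
rewrite big1 ?addr0 ?mulr2n ?mulrDl ?mul1r; first by ring.
by move=> v /andP[/andP[/orP[]/eqP-> ]]; rewrite eqxx.
Qed.

Lemma sum_w2_ge : oriented A -> weighting A w ->
  2 * weight w A <= Num.sqrt (maxdeg A)%:R * \sum_v w2 A w v.
Proof.
move=> A_or w_ge0; rewrite -sum_incident // mulr_sumr.
by apply: ler_sum => v _; apply: w2_ge.
Qed.

Lemma degree_bound : oriented A -> weighting A w -> (1 <= maxdeg A)%N ->
  Num.sqrt 2 * weight w A / (3 * Num.sqrt (maxdeg A)%:R)
  <= Num.sqrt 2 / 6 * \sum_v w2 A w v.
Proof.
move=> A_or w_ge0 deg_gt0.
have d_gt0 : 0 < Num.sqrt (maxdeg A)%:R :> R by rewrite sqrtr_gt0 ltr0n.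
rewrite ler_pdivrMr ?mulr_gt0 //.
by have := ler_wpM2l (sqrtr_ge0 2) (sum_w2_ge A_or w_ge0); lra.
Qed.

Lemma fas_bound : oriented A ->
  fas A w <= weight w A / 2 - Num.sqrt 2 / 12 * \sum_v w2 A w v.
Proof.
move=> A_or; have [s [s_ord le_s]] := main_ordering A_or.
apply: le_trans (fas_le (back_feedback A_or s_ord)) _.
by rewrite weight_fwd // in le_s; lra.
Qed.

Lemma fas_degree_bound : oriented A -> weighting A w -> (1 <= maxdeg A)%N ->
  weight w A / 2 - Num.sqrt 2 / 12 * \sum_v w2 A w v
  <= (1 / 2 - Num.sqrt 2 / (6 * Num.sqrt (maxdeg A)%:R)) * weight w A.
Proof.
move=> A_or w_ge0 deg_gt0; have := degree_bound A_or w_ge0 deg_gt0.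
have d_neq0 : Num.sqrt (maxdeg A)%:R != 0 :> R.
  by rewrite gt_eqF // sqrtr_gt0 ltr0n.
have -> : Num.sqrt 2 * weight w A / (3 * Num.sqrt (maxdeg A)%:R)
   = 2 * (Num.sqrt 2 / (6 * Num.sqrt (maxdeg A)%:R) * weight w A) by field.
by lra.
Qed.

End Digraphs.

(** * The directed triangle *)

Section Triangle.
Import mathcomp.boot.fintype mathcomp.boot.finset.
Variable R : realType.
Implicit Types (v : 'I_3) (F : {set 'I_3 * 'I_3}).

Let w : 'I_3 * 'I_3 -> R := unit_weight.

Lemma ordS_neq v : (v == ordS v) = false.
Proof. by case: v => [[|[|[|v]]] ?]; rewrite -val_eqE. Qed.

Lemma ordS_pred v x : (x == ord_pred v) = (ordS x == v).
Proof. by apply/eqP/eqP => [->|<-]; rewrite ?ord_predK ?ordSK. Qed.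

Lemma triangle_oriented : oriented triangle.
Proof.
split=> [v|x y]; rewrite !inE /= ?ordS_neq // => /eqP ->.
by case: x => [[|[|[|x]]] ?]; rewrite -val_eqE.
Qed.

Lemma triangle_out v : [set e in triangle | e.1 == v] = [set (v, ordS v)].
Proof.
apply/setP => -[x y]; rewrite !inE /= xpair_eqE andbC.
by case: (x =P v) => //= ->.
Qed.

Lemma triangle_in v : [set e in triangle | e.2 == v] = [set (ord_pred v, v)].
Proof.
apply/setP => -[x y]; rewrite !inE /= xpair_eqE ordS_pred.
by case: (y =P v) => [->|]; rewrite ?andbT ?andbF // eq_sym.
Qed.

Lemma triangle_maxdeg : maxdeg triangle = 2%N.
Proof.
have degE v : deg triangle v = 2%N.
  by rewrite /deg /outdeg /indeg triangle_out triangle_in !cards1.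
apply/eqP; rewrite eqn_leq; apply/andP; split.
  by apply/bigmax_leqP => v _; rewrite degE.
by rewrite -[leqLHS](degE ord0); apply: leq_bigmax.
Qed.

Lemma weight_unit F : weight w F = #|F|%:R.
Proof. by rewrite /weight sumr_const. Qed.

Lemma triangle_weight : weight w triangle = 3.
Proof.
rewrite weight_unit (_ : triangle = [set (v, ordS v) | v : 'I_3]).
  by rewrite card_imset ?card_ord // => u v [].
apply/setP => -[x y]; rewrite inE /=; apply/eqP/imsetP => [->|[v _ [-> ->]]] //.
by exists x.
Qed.

Lemma triangle_w2 v : w2 triangle w v = Num.sqrt 2.
Proof.
rewrite /w2; congr Num.sqrt.
have -> : \sum_(e in triangle | incident v e) w e ^+ 2
    = \sum_(e in [set (v, ordS v); (ord_pred v, v)]) 1.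
  rewrite -triangle_out -triangle_in; apply: eq_big => [e|e _].
    by rewrite !inE /incident andb_orr.
  by rewrite /w /unit_weight expr1n.
by rewrite sumr_const cards2 xpair_eqE ordS_pred andbb [ordS v == v]eq_sym ordS_neq.
Qed.

(** The three arcs form a directed cycle, so the empty set is not a feedback arc
    set. *)
Lemma triangle_feedback F : feedback_arc_set triangle F -> 1 <= weight w F.
Proof.
move=> [_ acyc]; rewrite weight_unit ler1n card_gt0; apply/eqP => F0.
suff /acyc : ucycle [rel x y | (x, y) \in triangle :\: F]
    [:: ord0; ordS ord0; ordS (ordS ord0)] by [].
rewrite F0 setD0; apply/andP; split=> //=.
by rewrite !inE.
Qed.

Lemma triangle_sum_w2 :
  Num.sqrt 2 / 6 * \sum_(v : 'I_3) w2 triangle w v = 1.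
Proof.
rewrite (eq_bigr (fun=> Num.sqrt 2)) => [|v _]; last exact: triangle_w2.
rewrite sumr_const card_ord -[_ *+ 3]mulr_natr.
have : Num.sqrt 2 ^+ 2 = 2 :> R by rewrite sqr_sqrtr.
by lra.
Qed.

(** The backward arcs form a feedback arc set, so they weigh at least 1 and the
    gain is at most 3 - 2. *)
Lemma triangle_gain_le s : is_ordering s ->
  weight w (fwd triangle s) - weight w (back triangle s)
  <= Num.sqrt 2 / 6 * \sum_(v : 'I_3) w2 triangle w v.
Proof.
move=> s_ord; rewrite weight_fwd ?triangle_weight ?triangle_sum_w2 //;
  last exact: triangle_oriented.
have := triangle_feedback (back_feedback triangle_oriented s_ord); lra.
Qed.

Lemma triangle_fas : fas triangle w = 1.
Proof.
apply/eqP; rewrite eq_le; apply/andP; split.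
  apply: le_trans (fas_bound w triangle_oriented) _.
  by have := triangle_sum_w2; rewrite triangle_weight; lra.
apply/Order.TotalTheory.bigmin_geP; split.
  by rewrite triangle_weight; lra.
by move=> F /asboolP; apply: triangle_feedback.
Qed.

End Triangle.

(** * The bounds and the optimal constant *)

Theorem theorem1 (R : realType) :
  (* the bounds for a general weighted oriented graph *)
  (forall (V : finType) (A : {set V * V}) (w : V * V -> R),
     oriented A -> (1 <= maxdeg A)%N -> weighting A w ->
     (exists s : seq V,
        [/\ is_ordering s,
            weight w (fwd A s) - weight w (back A s)
              >= Num.sqrt 2 / 6 * \sum_(v : V) w2 A w v
          & Num.sqrt 2 / 6 * \sum_(v : V) w2 A w v
              >= Num.sqrt 2 * weight w A / (3 * Num.sqrt (maxdeg A)%:R)])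
     /\ fas A w <= weight w A / 2 - Num.sqrt 2 / 12 * \sum_(v : V) w2 A w v
     /\ weight w A / 2 - Num.sqrt 2 / 12 * \sum_(v : V) w2 A w v
          <= (1 / 2 - Num.sqrt 2 / (6 * Num.sqrt (maxdeg A)%:R)) * weight w A)
  /\
  (* equality throughout for the unit-weight directed triangle *)
  (let A := triangle in
   let w : 'I_3 * 'I_3 -> R := unit_weight in
   [/\ (exists2 s : seq 'I_3, is_ordering s
          & weight w (fwd A s) - weight w (back A s)
            = Num.sqrt 2 / 6 * \sum_(v : 'I_3) w2 A w v)
       /\ (forall s : seq 'I_3, is_ordering s ->
             weight w (fwd A s) - weight w (back A s)
             <= Num.sqrt 2 / 6 * \sum_(v : 'I_3) w2 A w v),
       Num.sqrt 2 / 6 * \sum_(v : 'I_3) w2 A w v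
         = Num.sqrt 2 * weight w A / (3 * Num.sqrt (maxdeg A)%:R),
       fas A w = weight w A / 2 - Num.sqrt 2 / 12 * \sum_(v : 'I_3) w2 A w v
     & weight w A / 2 - Num.sqrt 2 / 12 * \sum_(v : 'I_3) w2 A w v
         = (1 / 2 - Num.sqrt 2 / (6 * Num.sqrt (maxdeg A)%:R)) * weight w A])
  /\
  (* the optimal constant *)
  (has_inf (fas_ratios R) /\ inf (fas_ratios R) = Num.sqrt 2 / 6).
Proof.
have s2_neq0 : Num.sqrt 2 != 0 :> R by rewrite gt_eqF // sqrtr_gt0.
have s2_sqr : Num.sqrt 2 ^+ 2 = 2 :> R by rewrite sqr_sqrtr.
split=> [V A w A_or deg_gt0 w_ge0|].
  split; last by split; [apply: fas_bound | apply: fas_degree_bound].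
  have [s [s_ord le_s]] := main_ordering w A_or.
  by exists s; split=> //; apply: degree_bound.
split=> [/=|].
  split.
  - split; last exact: triangle_gain_le.
    have [s [s_ord le_s]] := main_ordering (@unit_weight R _) triangle_oriented.
    exists s => //; apply/eqP; rewrite eq_le le_s andbT.
    exact: triangle_gain_le.
  - rewrite triangle_sum_w2 triangle_weight triangle_maxdeg.
    by field.
  - have := triangle_sum_w2 R; rewrite triangle_fas triangle_weight; lra.
  - have := triangle_sum_w2 R; rewrite triangle_weight triangle_maxdeg => sum1.
    rewrite (_ : Num.sqrt 2 / (6 * Num.sqrt 2%:R) = 1 / 6); last by field.
    by lra.
have lower : lbound (fas_ratios R) (Num.sqrt 2 / 6).
  move=> _ [V [A [w [A_or w_ge0 deg_gt0 wA_gt0 ->]]]].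
  have d_gt0 : 0 < Num.sqrt (maxdeg A)%:R :> R by rewrite sqrtr_gt0 ltr0n.
  have le_fas := le_trans (fas_bound w A_or) (fas_degree_bound A_or w_ge0 deg_gt0).
  rewrite -ler_pdivrMl // lerBrDl -lerBrDr ler_pdivrMr //.
  rewrite (_ : _^-1 * _ = Num.sqrt 2 / (6 * Num.sqrt (maxdeg A)%:R)) //.
  by field; rewrite gt_eqF.
have attained : fas_ratios R (Num.sqrt 2 / 6).
  exists 'I_3, triangle, unit_weight; split=> //.
  - exact: triangle_oriented.
  - by rewrite triangle_maxdeg.
  - by rewrite triangle_weight.
  - by rewrite triangle_fas triangle_weight triangle_maxdeg; field.
have hinf : has_inf (fas_ratios R).
  by split; [exists (Num.sqrt 2 / 6) | exists (Num.sqrt 2 / 6)].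
split=> //; apply/eqP; rewrite eq_le; apply/andP; split.
  by apply: ge_inf => //; case: hinf.
by apply: lb_le_inf => //; case: hinf.
Qed.
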